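(* Let $X$ be an algebraic variety over $k$ and let $\varphi\colon \mathbb{G}_{\mathrm{m}}\times X\dashrightarrow X$ be a faithful rational $\mathbb{G}_{\mathrm{m}}$-action with comorphism $\varphi^*\colon K_X\to K_X(t)$. Then there exists a rational slice, i.e., a nonzero element $s\in K_X$ such that $\varphi^*(s)=ts$.
   Context: Let $k$ be an algebraically closed field of characteristic zero. A variety is an integral separated scheme of finite type over $k$; $K_X$ is the field of rational functions of $X$. $\mathbb{G}_{\mathrm{m}}$ is the multiplicative group over $k$, with coordinate $t$, group law $\mu$ and neutral element $e\colon \operatorname{Spec}(k)\to\mathbb{G}_{\mathrm{m}}$. A rational $\mathbb{G}_{\mathrm{m}}$-action on $X$ is a rational map $\varphi\colon \mathbb{G}_{\mathrm{m}}\times X\dashrightarrow X$ such that, as rational maps, $\varphi\circ(\mathrm{id}_{\mathbb{G}_{\mathrm{m}}}\times\varphi)=\varphi\circ(\mu\times \mathrm{id}_X)$ on $\mathbb{G}_{\mathrm{m}}\times\mathbb{G}_{\mathrm{m}}\times X$ and $\varphi\circ(e\times \mathrm{id}_X)=\mathrm{pr}_2$ on $\operatorname{Spec}(k)\times X$. Its comorphism is the induced field homomorphism $\varphi^*\colon K_X\to k(\mathbb{G}_{\mathrm{m}}\times X)=K_X(t)$. Every $g\in\mathbb{G}_{\mathrm{m}}$ gives a birational automorphism $\varphi_g\colon X\dashrightarrow X$, $x\mapsto\varphi(g,x)$, and $g\mapsto\varphi_g$ is a group homomorphism $\mathbb{G}_{\mathrm{m}}\to\operatorname{Bir}(X)$;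 the action is faithful if this homomorphism is injective. *)

(* Defs.v *)
(* Varieties over an algebraically closed field k are taken in the classical
   sense (Serre, FAC; Kempf, "Algebraic varieties"): spaces with a sheaf of
   k-valued functions that are irreducible, separated and covered by finitely
   many open subspaces isomorphic to closed subsets of affine spaces.  Since k
   is algebraically closed, X |-> X(k) is an equivalence from integral separated
   schemes of finite type over k to these, compatible with open subsets, fibre
   products over k, rational maps and function fields. *)
From HB Require Import structures.
From mathcomp Require Import mpoly.
From mathcomp Require Import all_boot all_order all_algebra.
From mathcomp Require Import generic_quotient.
From mathcomp Require Import boolp classical_sets topology.

Set Implicit Arguments.
Unset Strict Implicit.
Unset Printing Implicit Defensive.

Import GRing.Theory.
Local Open Scope ring_scope.
Local Open Scope classical_set_scope.
Local Open Scope quotient_scope.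

(* [regular U f] says that the restriction of f to the open set U is a section
   over U of the structure sheaf; the values of f outside U are irrelevant, and
   [regular U] is only meaningful for open U. *)
Record funSpace (k : fieldType) := FunSpace {
  pt :> topologicalType;
  regular : set pt -> (pt -> k) -> Prop;
  regular_ext : forall U f g, open U -> (forall x, U x -> f x = g x) ->
    regular U f -> regular U g;
  regular_restr : forall U V f, open U -> open V -> V `<=` U ->
    regular U f -> regular V f;
  regular_glue : forall U f, open U ->
    (forall x, U x -> exists V, [/\ open V, V x, V `<=` U & regular V f]) ->
    regular U f;
  regular_cst : forall U c, open U -> regular U (fun=> c);
  regular_add : forall U f g, open U -> regular U f -> regular U g ->
    regular U (fun x => f x + g x);
  regular_mul : forall U f g, open U -> regular U f -> regular U g ->
    regular U (fun x => f x * g x);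
  regular_neq0 : forall U f, open U -> regular U f ->
    open (U `&` [set x | f x != 0]);
  regular_inv : forall U f, open U -> regular U f ->
    regular (U `&` [set x | f x != 0]) (fun x => (f x)^-1)
}.

(* A collection of pairs (U, f), f being a function on U, closed under the
   operations needed for the non-vanishing loci U `&` {f != 0} to be a base of
   a topology. *)
Record funBase (k : fieldType) (T : Type) := FunBase {
  fbase :> set T -> (T -> k) -> Prop;
  fbase_cst : forall c, fbase setT (fun=> c);
  fbase_add : forall U V f g, fbase U f -> fbase V g ->
    fbase (U `&` V) (fun x => f x + g x);
  fbase_mul : forall U V f g, fbase U f -> fbase V g ->
    fbase (U `&` V) (fun x => f x * g x)
}.

Definition genPt (k : fieldType) (T : choiceType) (F : funBase k T) : Type := T.

Section Generated.
Context (k : fieldType) (T : choiceType) (F : funBase k T).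

HB.instance Definition _ := Choice.on (genPt F).

Definition genOpen (W : set (genPt F)) : Prop :=
  forall x, W x -> exists U f,
    [/\ F U f, U x, f x != 0 & U `&` [set y | f y != 0] `<=` W].

Lemma genOpenT : genOpen setT.
Proof.
move=> x _; exists setT, (fun=> 1); split=> //; first exact: fbase_cst.
exact: oner_neq0.
Qed.

Lemma genOpenI : setI_closed genOpen.
Proof.
move=> A B oA oB x [Ax Bx].
have [U [f [Ff Ux fx sU]]] := oA x Ax; have [V [g [Fg Vx gx sV]]] := oB x Bx.
exists (U `&` V), (fun y => f y * g y); split.
- exact: fbase_mul.
- by split.
- by rewrite mulf_neq0.
- move=> y [[Uy Vy]] /=; rewrite mulf_eq0 negb_or => /andP[fy gy].
  by split; [apply: sU | apply: sV].
Qed.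

Lemma genOpen_bigU (I : Type) (f : I -> set (genPt F)) :
  (forall i, genOpen (f i)) -> genOpen (\bigcup_i f i).
Proof.
move=> of_ x [i _ fx]; have [U [g [Fg Ux gx sU]]] := of_ i x fx.
by exists U, g; split=> // y /sU; exists i.
Qed.

HB.instance Definition _ :=
  isOpenTopological.Build (genPt F) genOpenT genOpenI genOpen_bigU.

Lemma genOpenE (W : set (genPt F)) : open W = genOpen W.
Proof. by []. Qed.

Definition genRegular (W : set (genPt F)) (h : genPt F -> k) : Prop :=
  forall x, W x -> exists U f g, [/\ F U f, F U g, U x, g x != 0
    & forall y, W y -> U y -> g y != 0 -> h y = f y / g y].

Lemma genRegular_ext U f g : open U -> (forall x, U x -> f x = g x) ->
  genRegular U f -> genRegular U g.
Proof.
move=> _ efg rf x Ux; have [V [a [b [Fa Fb Vx bx e]]]] := rf x Ux.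
by exists V, a, b; split=> // y Uy Vy nb; rewrite -efg // e.
Qed.

Lemma genRegular_restr U V f : open U -> open V -> V `<=` U ->
  genRegular U f -> genRegular V f.
Proof.
move=> _ _ sVU rf x Vx; have [W [a [b [Fa Fb Wx bx e]]]] := rf x (sVU x Vx).
by exists W, a, b; split=> // y Vy; apply: e; apply: sVU.
Qed.

Lemma genRegular_glue U f : open U ->
  (forall x, U x -> exists V, [/\ open V, V x, V `<=` U & genRegular V f]) ->
  genRegular U f.
Proof.
move=> _ lf x Ux; have [V [oV Vx sVU rf]] := lf x Ux.
have [W [a [b [Fa Fb Wx bx e]]]] := rf x Vx.
move: oV; rewrite genOpenE => /(_ x Vx)[V' [c [Fc V'x cx sV']]].
exists (W `&` V'), (fun y => a y * c y), (fun y => b y * c y); split=> //.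
- exact: fbase_mul.
- exact: fbase_mul.
- by rewrite mulf_neq0.
- move=> y Uy [Wy V'y]; rewrite mulf_eq0 negb_or => /andP[by0 cy0].
  by rewrite -mulf_div divff // mulr1 e //; apply: sV'.
Qed.

Lemma genRegular_cst U c : open U -> genRegular U (fun=> c).
Proof.
move=> _ x Ux; exists setT, (fun=> c), (fun=> 1).
split=> //; try exact: fbase_cst; first exact: oner_neq0.
by move=> *; rewrite divr1.
Qed.

Lemma genRegular_add U f g : open U -> genRegular U f -> genRegular U g ->
  genRegular U (fun x => f x + g x).
Proof.
move=> _ rf rg x Ux.
have [V [a [b [Fa Fb Vx bx e]]]] := rf x Ux.
have [W [c [d [Fc Fd Wx dx e']]]] := rg x Ux.
exists (V `&` W), (fun y => a y * d y + c y * b y), (fun y => b y * d y).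
split=> //.
- have -> : V `&` W = (V `&` W) `&` (W `&` V) by rewrite [W `&` V]setIC setIid.
  by apply: fbase_add; apply: fbase_mul.
- exact: fbase_mul.
- by rewrite mulf_neq0.
- move=> y Uy [Vy Wy]; rewrite mulf_eq0 negb_or => /andP[by0 dy0].
  by rewrite e // e' // addf_div.
Qed.

Lemma genRegular_mul U f g : open U -> genRegular U f -> genRegular U g ->
  genRegular U (fun x => f x * g x).
Proof.
move=> _ rf rg x Ux.
have [V [a [b [Fa Fb Vx bx e]]]] := rf x Ux.
have [W [c [d [Fc Fd Wx dx e']]]] := rg x Ux.
exists (V `&` W), (fun y => a y * c y), (fun y => b y * d y).
split=> //.
- exact: fbase_mul.
- exact: fbase_mul.
- by rewrite mulf_neq0.
- move=> y Uy [Vy Wy]; rewrite mulf_eq0 negb_or => /andP[by0 dy0].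
  by rewrite e // e' // mulf_div.
Qed.

Lemma genRegular_neq0 U f : open U -> genRegular U f ->
  open (U `&` [set x | f x != 0]).
Proof.
rewrite !genOpenE => oU rf x [Ux /= fx].
have [V [a [b [Fa Fb Vx bx e]]]] := rf x Ux.
have [W [c [Fc Wx cx sW]]] := oU x Ux.
have ax : a x != 0.
  by apply: contraNneq fx => a0; rewrite e // a0 mul0r.
exists ((V `&` V) `&` W), (fun y => a y * b y * c y); split=> //.
- by do 2?apply: fbase_mul.
- by rewrite !mulf_neq0.
- move=> y [[[Vy _] Wy]] /=; rewrite !mulf_eq0 !negb_or => /andP[/andP[ay0 by0] cy0].
  have Uy : U y by apply: sW.
  by split=> //=; rewrite e // mulf_neq0 // invr_eq0.
Qed.

Lemma genRegular_inv U f : open U -> genRegular U f ->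
  genRegular (U `&` [set x | f x != 0]) (fun x => (f x)^-1).
Proof.
move=> oU rf x [Ux /= fx].
have [V [a [b [Fa Fb Vx bx e]]]] := rf x Ux.
have ax : a x != 0.
  by apply: contraNneq fx => a0; rewrite e // a0 mul0r.
exists (V `&` V), (fun y => b y * b y), (fun y => a y * b y); split=> //.
- exact: fbase_mul.
- exact: fbase_mul.
- by rewrite mulf_neq0.
- move=> y [Uy /= fy] [Vy _]; rewrite mulf_eq0 negb_or => /andP[ay0 by0].
  by rewrite e // invf_div -mulf_div divff // mulr1.
Qed.

(* Opens are the unions of the sets U `&` {f != 0}, regular functions are the
   functions that are locally quotients f / g, for (U, f) and (U, g) in F. *)
Definition genSpace : funSpace k :=
  @FunSpace k (genPt F) genRegular genRegular_ext genRegular_restr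
    genRegular_glue genRegular_cst genRegular_add genRegular_mul
    genRegular_neq0 genRegular_inv.

End Generated.

Section Constructions.
Context (k : fieldType).

Section Affine.
Context (n : nat).

Definition affBase_pred (U : set 'rV[k]_n) (f : 'rV[k]_n -> k) : Prop :=
  U = setT /\ exists p : {mpoly k[n]},
    forall v, f v = meval (fun i => v ord0 i) p.

Lemma affBase_cst c : affBase_pred setT (fun=> c).
Proof.
by split=> //; exists (mpolyC n c) => v; rewrite mevalC.
Qed.

Lemma affBase_add U V f g : affBase_pred U f -> affBase_pred V g ->
  affBase_pred (U `&` V) (fun x => f x + g x).
Proof.
move=> [-> [p fE]] [-> [q gE]]; split; first by rewrite setIT.
by exists (p + q) => v; rewrite mevalD fE gE.
Qed.

Lemma affBase_mul U V f g : affBase_pred U f -> affBase_pred V g ->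
  affBase_pred (U `&` V) (fun x => f x * g x).
Proof.
move=> [-> [p fE]] [-> [q gE]]; split; first by rewrite setIT.
by exists (p * q) => v; rewrite mevalM fE gE.
Qed.

Definition affSpace : funSpace k :=
  genSpace (FunBase affBase_cst affBase_add affBase_mul).

End Affine.

Section Sub.
Context (X : funSpace k) (A : set X).

Definition subBase_pred (U : set (set_type A)) (f : set_type A -> k) : Prop :=
  exists (V : set X) (h : X -> k), [/\ open V, regular V h,
    U = [set x | V (val x)] & forall x, f x = h (val x)].

Lemma subBase_cst c : subBase_pred setT (fun=> c).
Proof.
exists setT, (fun=> c); split=> //; first exact: openT.
by apply: regular_cst; apply: openT.
Qed.

Lemma subBase_add U V f g : subBase_pred U f -> subBase_pred V g ->
  subBase_pred (U `&` V) (fun x => f x + g x).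
Proof.
move=> [U' [f' [oU rf -> fE]]] [V' [g' [oV rg -> gE]]].
have oI : open (U' `&` V') by apply: openI.
exists (U' `&` V'), (fun x => f' x + g' x); split=> //.
- apply: regular_add => //.
  + exact: (regular_restr oU oI (@subIsetl _ _ _) rf).
  + exact: (regular_restr oV oI (@subIsetr _ _ _) rg).
- by move=> x; rewrite fE gE.
Qed.

Lemma subBase_mul U V f g : subBase_pred U f -> subBase_pred V g ->
  subBase_pred (U `&` V) (fun x => f x * g x).
Proof.
move=> [U' [f' [oU rf -> fE]]] [V' [g' [oV rg -> gE]]].
have oI : open (U' `&` V') by apply: openI.
exists (U' `&` V'), (fun x => f' x * g' x); split=> //.
- apply: regular_mul => //.
  + exact: (regular_restr oU oI (@subIsetl _ _ _) rf).
  + exact: (regular_restr oV oI (@subIsetr _ _ _) rg).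
- by move=> x; rewrite fE gE.
Qed.

(* The subset A with the induced topology; regular functions are those that are
   locally restrictions of regular functions of X. *)
Definition subSpace : funSpace k :=
  genSpace (FunBase subBase_cst subBase_add subBase_mul).

End Sub.

Section Prod.
Context (X Y : funSpace k).

(* Functions sum_i f_i(x) g_i(y) on U x V, with f_i regular on U and g_i regular
   on V: they generate the product in the category of spaces with functions
   (hence of varieties), whose topology is finer than the product topology. *)
Definition prodBase_pred (W : set (X * Y)%type) (h : (X * Y)%type -> k) : Prop :=
  exists (U : set X) (V : set Y) (s : seq ((X -> k) * (Y -> k))),
    [/\ open U, open V, W = U `*` V,
      forall i, (i < size s)%N ->
        regular U (nth (fun=> 0, fun=> 0) s i).1 /\
        regular V (nth (fun=> 0, fun=> 0) s i).2
    & forall z, h z = \sum_(p <- s) p.1 z.1 * p.2 z.2].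

Lemma prodBase_cst c : prodBase_pred setT (fun=> c).
Proof.
exists setT, setT, [:: (fun=> c, fun=> 1)]; split.
- exact: openT.
- exact: openT.
- by rewrite setXTT.
- move=> [|[]] //= _; split; apply: regular_cst; exact: openT.
- by move=> z; rewrite big_seq1 mulr1.
Qed.

Lemma prodBase_add W W' f g : prodBase_pred W f -> prodBase_pred W' g ->
  prodBase_pred (W `&` W') (fun x => f x + g x).
Proof.
move=> [U [V [s [oU oV -> rs fE]]]] [U' [V' [s' [oU' oV' -> rs' gE]]]].
have oUI := openI oU oU'; have oVI := openI oV oV'.
exists (U `&` U'), (V `&` V'), (s ++ s'); split=> //.
- by rewrite setXI.
- move=> i; rewrite size_cat nth_cat; case: (ltnP i (size s)) => [lti _|lei ltis].
    have [r1 r2] := rs i lti; split.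
      exact: (regular_restr oU oUI (@subIsetl _ _ _) r1).
    exact: (regular_restr oV oVI (@subIsetl _ _ _) r2).
  have lt' : (i - size s < size s')%N by rewrite ltn_subLR.
  have [r1 r2] := rs' _ lt'; split.
    exact: (regular_restr oU' oUI (@subIsetr _ _ _) r1).
  exact: (regular_restr oV' oVI (@subIsetr _ _ _) r2).
- by move=> z; rewrite big_cat /= fE gE.
Qed.

Lemma prodBase_mul W W' f g : prodBase_pred W f -> prodBase_pred W' g ->
  prodBase_pred (W `&` W') (fun x => f x * g x).
Proof.
move=> [U [V [s [oU oV -> rs fE]]]] [U' [V' [s' [oU' oV' -> rs' gE]]]].
have oUI := openI oU oU'; have oVI := openI oV oV'.
pose m (p q : (X -> k) * (Y -> k)) : (X -> k) * (Y -> k) :=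
  (fun x => p.1 x * q.1 x, fun y => p.2 y * q.2 y).
exists (U `&` U'), (V `&` V'), [seq m p q | p <- s, q <- s']; split=> //.
- by rewrite setXI.
- have {fE gE} : forall p q, regular U p.1 /\ regular V p.2 ->
      regular U' q.1 /\ regular V' q.2 ->
      regular (U `&` U') (m p q).1 /\ regular (V `&` V') (m p q).2.
    move=> p q [p1 p2] [q1 q2]; split; apply: regular_mul => //.
    + exact: (regular_restr oU oUI (@subIsetl _ _ _) p1).
    + exact: (regular_restr oU' oUI (@subIsetr _ _ _) q1).
    + exact: (regular_restr oV oVI (@subIsetl _ _ _) p2).
    + exact: (regular_restr oV' oVI (@subIsetr _ _ _) q2).
  move=> rm; elim: s rs => [|p s IH] rs //= i.
  rewrite size_cat size_map nth_cat size_map; case: (ltnP i (size s')) => [lti _|lei ltis].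
    rewrite (nth_map (fun=> 0, fun=> 0)) //.
    by apply: rm; [apply: (rs 0%N) | apply: rs'].
  apply: IH; first by move=> j; apply: (rs j.+1).
  by rewrite ltn_subLR.
- move=> z; rewrite big_allpairs_dep /= fE gE mulr_suml.
  apply: eq_bigr => p _; rewrite mulr_sumr; apply: eq_bigr => q _ /=.
  by rewrite mulrACA.
Qed.

Definition prodSpace : funSpace k :=
  genSpace (FunBase prodBase_cst prodBase_add prodBase_mul).

End Prod.

Definition morphism_on (X Y : funSpace k) (U : set X) (f : X -> Y) : Prop :=
  forall V : set Y, open V -> open (U `&` f @^-1` V) /\
    forall h, regular V h -> regular (U `&` f @^-1` V) (h \o f).

Definition isomorphic (X Y : funSpace k) : Prop :=
  exists (f : X -> Y) (g : Y -> X),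
    [/\ morphism_on setT f, morphism_on setT g, cancel f g & cancel g f].

Definition affine (X : funSpace k) : Prop :=
  exists (n : nat) (Z : set (affSpace n)),
    closed Z /\ isomorphic X (subSpace Z).

Definition irreducible (X : funSpace k) : Prop :=
  [set: X] !=set0 /\
  forall U V : set X, open U -> open V -> U !=set0 -> V !=set0 ->
    U `&` V !=set0.

Definition separated (X : funSpace k) : Prop :=
  closed [set z : prodSpace X X | z.1 = z.2].

Definition finite_affine_cover (X : funSpace k) : Prop :=
  exists (m : nat) (U : 'I_m -> set X),
    (forall i, open (U i) /\ affine (subSpace (U i))) /\
    \bigcup_i U i = setT.

End Constructions.

Record irrSpace (k : fieldType) := IrrSpace {
  irr_space :> funSpace k;
  irr_spaceP : irreducible irr_space
}.

Record variety (k : fieldType) := Variety {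
  var_space :> irrSpace k;
  var_separated : separated var_space;
  var_finite_type : finite_affine_cover var_space
}.

Section IrrTheory.
Context (k : fieldType).

Lemma irrI (X : irrSpace k) (U V : set X) : open U -> open V ->
  U !=set0 -> V !=set0 -> U `&` V !=set0.
Proof. exact: (irr_spaceP X).2. Qed.

Lemma irrT (X : irrSpace k) : [set: X] !=set0.
Proof. exact: (irr_spaceP X).1. Qed.

Lemma regular_sum (X : funSpace k) (U : set X) (I : Type) (s : seq I)
    (F : I -> X -> k) (z : I) : open U ->
  (forall i, (i < size s)%N -> regular U (F (nth z s i))) ->
  regular U (fun x => \sum_(i <- s) F i x).
Proof.
move=> oU; elim: s => [|i s IH] rF.
  apply: (regular_ext oU _ (regular_cst 0 oU)) => x _.
  by rewrite big_nil.
have r1 := rF 0%N isT; have r2 := IH (fun j => rF j.+1).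
apply: (regular_ext oU _ (regular_add oU r1 r2)) => x _.
by rewrite big_cons.
Qed.

Lemma prod_openP (X Y : funSpace k) (W : set (prodSpace X Y)) :
  open W = genOpen W.
Proof. by []. Qed.

Lemma prod_slicel (X Y : funSpace k) (W : set (prodSpace X Y)) (y : Y) :
  open W -> open [set x | W (x, y)].
Proof.
rewrite prod_openP => oW; rewrite openE => x /= /oW.
move=> [_ [h [[U [V [s [oU oV -> rs hE]]]] [/= Ux Vy] hx sW]]].
rewrite /interior nbhsE /=.
have rh : regular U (fun x' => \sum_(p <- s) p.1 x' * p.2 y).
  apply: (regular_sum (F := fun p x' => p.1 x' * p.2 y)
    (z := (fun=> 0, fun=> 0)) oU) => i /rs[r1 _].
  exact: (regular_mul oU r1 (regular_cst _ oU)).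
exists (U `&` [set x' | \sum_(p <- s) p.1 x' * p.2 y != 0]).
  by split; [exact: regular_neq0 | split=> //=; move: hx; rewrite hE].
by move=> x' [Ux' nz]; apply: sW; split=> //=; rewrite hE.
Qed.

Lemma prod_slicer (X Y : funSpace k) (W : set (prodSpace X Y)) (x : X) :
  open W -> open [set y | W (x, y)].
Proof.
rewrite prod_openP => oW; rewrite openE => y /= /oW.
move=> [_ [h [[U [V [s [oU oV -> rs hE]]]] [/= Ux Vy] hy sW]]].
rewrite /interior nbhsE /=.
have rh : regular V (fun y' => \sum_(p <- s) p.1 x * p.2 y').
  apply: (regular_sum (F := fun p y' => p.1 x * p.2 y')
    (z := (fun=> 0, fun=> 0)) oV) => i /rs[_ r2].
  exact: (regular_mul oV (regular_cst _ oV) r2).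
exists (V `&` [set y' | \sum_(p <- s) p.1 x * p.2 y' != 0]).
  by split; [exact: regular_neq0 | split=> //=; move: hy; rewrite hE].
by move=> y' [Vy' nz]; apply: sW; split=> //=; rewrite hE.
Qed.

Lemma prod_irreducible (X Y : irrSpace k) : irreducible (prodSpace X Y).
Proof.
split.
  by have [x _] := irrT X; have [y _] := irrT Y; exists (x, y).
move=> W W' oW oW' [[x y] Wxy] [[x' y'] Wxy'].
have [x0 [/= W0 W0']] : [set a | W (a, y)] `&` [set a | W' (a, y')] !=set0.
  by apply: irrI; [exact: prod_slicel | exact: prod_slicel | exists x | exists x'].
have [y0 [/= W1 W1']] : [set b | W (x0, b)] `&` [set b | W' (x0, b)] !=set0.
  by apply: irrI; [exact: prod_slicer | exact: prod_slicer | exists y | exists y'].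
by exists (x0, y0).
Qed.

Definition irrProd (X Y : irrSpace k) : irrSpace k :=
  IrrSpace (prod_irreducible X Y).

End IrrTheory.

Section FunctionField.
Context (k : fieldType) (X : irrSpace k).

Record ratRep := RatRep {
  rdom : set X;
  rval : X -> k;
  rdom_open : open rdom;
  rdom_neq0 : rdom !=set0;
  rval_regular : regular rdom rval
}.

HB.instance Definition _ := gen_eqMixin ratRep.
HB.instance Definition _ := gen_choiceMixin ratRep.

Definition ratRep_eqP (f g : ratRep) : Prop :=
  exists W, [/\ open W, W !=set0, W `<=` rdom f `&` rdom g
    & forall x, W x -> rval f x = rval g x].

Definition ratRep_eq (f g : ratRep) : bool := `[< ratRep_eqP f g >].

Lemma ratRep_eq_refl : reflexive ratRep_eq.
Proof.
move=> f; apply/asboolP; exists (rdom f); split=> //.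
- exact: rdom_open.
- exact: rdom_neq0.
Qed.

Lemma ratRep_eq_sym : symmetric ratRep_eq.
Proof.
suff H f g : ratRep_eq f g -> ratRep_eq g f.
  by move=> f g; apply/idP/idP; apply: H.
move=> /asboolP[W [oW nW sW e]]; apply/asboolP; exists W; split=> //.
  by rewrite setIC.
by move=> x Wx; rewrite e.
Qed.

Lemma ratRep_eq_trans : transitive ratRep_eq.
Proof.
move=> g f h /asboolP[W [oW nW sW e]] /asboolP[W' [oW' nW' sW' e']].
apply/asboolP; exists (W `&` W'); split.
- exact: openI.
- exact: irrI.
- by move=> x [/sW[? _] /sW'[_ ?]].
- by move=> x [Wx W'x]; rewrite e // e'.
Qed.

Canonical ratRep_equiv :=
  EquivRel ratRep_eq ratRep_eq_refl ratRep_eq_sym ratRep_eq_trans.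

Definition funField := {eq_quot ratRep_eq}.
HB.instance Definition _ := EqQuotient.on funField.
HB.instance Definition _ := Choice.on funField.

Definition rcst (c : k) : ratRep :=
  RatRep openT (irrT X) (regular_cst c openT).

Lemma rI_open (f g : ratRep) : open (rdom f `&` rdom g).
Proof. by apply: openI; apply: rdom_open. Qed.

Lemma rI_neq0 (f g : ratRep) : rdom f `&` rdom g !=set0.
Proof. by apply: irrI; (apply: rdom_open || apply: rdom_neq0). Qed.

Lemma rI_regl (f g : ratRep) : regular (rdom f `&` rdom g) (rval f).
Proof.
exact: (regular_restr (rdom_open f) (rI_open f g) (@subIsetl _ _ _)
  (rval_regular f)).
Qed.

Lemma rI_regr (f g : ratRep) : regular (rdom f `&` rdom g) (rval g).
Proof.
exact: (regular_restr (rdom_open g) (rI_open f g) (@subIsetr _ _ _)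
  (rval_regular g)).
Qed.

Definition radd (f g : ratRep) : ratRep :=
  RatRep (rI_open f g) (rI_neq0 f g)
    (regular_add (rI_open f g) (rI_regl f g) (rI_regr f g)).

Definition rmul (f g : ratRep) : ratRep :=
  RatRep (rI_open f g) (rI_neq0 f g)
    (regular_mul (rI_open f g) (rI_regl f g) (rI_regr f g)).

Definition ropp (f : ratRep) : ratRep := rmul (rcst (-1)) f.

Definition rnz (f : ratRep) : set X := rdom f `&` [set x | rval f x != 0].

Lemma rnz_open f : open (rnz f).
Proof. exact: (regular_neq0 (rdom_open f) (rval_regular f)). Qed.

Definition rinv (f : ratRep) : ratRep :=
  match pselect (rnz f !=set0) with
  | left nz => RatRep (rnz_open f) nz
      (regular_inv (rdom_open f) (rval_regular f))
  | right _ => rcst 0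
  end.

Lemma ratRep_eqmodP f g : reflect (ratRep_eqP f g) (f == g %[mod funField]).
Proof. by rewrite eqmodE /=; apply: asboolP. Qed.

Lemma ratRep_eqI f g :
  (forall x, rdom f x -> rdom g x -> rval f x = rval g x) ->
  \pi_funField f = \pi_funField g.
Proof.
move=> e; apply/eqP/ratRep_eqmodP; exists (rdom f `&` rdom g); split=> //.
- exact: rI_open.
- exact: rI_neq0.
- by move=> x []; apply: e.
Qed.

Definition ff_cst (c : k) : funField := \pi_funField (rcst c).
Definition ff_add := lift_op2 funField radd.
Definition ff_mul := lift_op2 funField rmul.
Definition ff_opp := lift_op1 funField ropp.
Definition ff_inv := lift_op1 funField rinv.

Lemma reprE (f : ratRep) : ratRep_eqP (repr (\pi_funField f)) f.
Proof. by apply/ratRep_eqmodP; rewrite reprK. Qed.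

Lemma ff_addE f g : ff_add (\pi_funField f) (\pi_funField g) = \pi_funField (radd f g).
Proof.
unlock ff_add.
have [W [oW nW sW e]] := reprE f; have [W' [oW' nW' sW' e']] := reprE g.
apply/eqP/ratRep_eqmodP; exists (W `&` W'); split.
- exact: openI.
- exact: irrI.
- by move=> x [/sW[? ?] /sW'[? ?]]; split; split.
- by move=> x [Wx W'x] /=; rewrite e // e'.
Qed.

Lemma ff_mulE f g : ff_mul (\pi_funField f) (\pi_funField g) = \pi_funField (rmul f g).
Proof.
unlock ff_mul.
have [W [oW nW sW e]] := reprE f; have [W' [oW' nW' sW' e']] := reprE g.
apply/eqP/ratRep_eqmodP; exists (W `&` W'); split.
- exact: openI.
- exact: irrI.
- by move=> x [/sW[? ?] /sW'[? ?]]; split; split.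
- by move=> x [Wx W'x] /=; rewrite e // e'.
Qed.

Lemma ff_oppE f : ff_opp (\pi_funField f) = \pi_funField (ropp f).
Proof.
unlock ff_opp; have [W [oW nW sW e]] := reprE f.
apply/eqP/ratRep_eqmodP; exists W; split=> //.
- by move=> x /sW[? ?]; split; split.
- by move=> x Wx /=; rewrite e.
Qed.

Lemma rinv_val f x : rdom (rinv f) x -> rdom f x -> rval (rinv f) x = (rval f x)^-1.
Proof.
rewrite /rinv; case: pselect => //= nz _ fx; apply/esym/eqP; rewrite invr_eq0.
by apply/negPn/negP => n0; apply: nz; exists x.
Qed.

Lemma ff_invE f : ff_inv (\pi_funField f) = \pi_funField (rinv f).
Proof.
unlock ff_inv; have [W [oW nW sW e]] := reprE f.
set g := repr _ in sW e *.
apply/eqP/ratRep_eqmodP; exists (W `&` (rdom (rinv g) `&` rdom (rinv f))); split.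
- by apply: openI => //; apply: rI_open.
- by apply: irrI => //; [apply: rI_open | apply: rI_neq0].
- by move=> x [].
- move=> x [Wx [gx fx]]; have [gx' fx'] := sW x Wx.
  by rewrite !rinv_val // e.
Qed.

Lemma ff_addA : associative ff_add.
Proof.
move=> x y z; rewrite -[x]reprK -[y]reprK -[z]reprK !ff_addE.
by apply: ratRep_eqI => a _ _ /=; rewrite addrA.
Qed.

Lemma ff_addC : commutative ff_add.
Proof.
move=> x y; rewrite -[x]reprK -[y]reprK !ff_addE.
by apply: ratRep_eqI => a _ _ /=; rewrite addrC.
Qed.

Lemma ff_add0 : left_id (ff_cst 0) ff_add.
Proof.
move=> x; rewrite -[x]reprK !ff_addE.
by apply: ratRep_eqI => a _ _ /=; rewrite add0r.
Qed.

Lemma ff_addN : left_inverse (ff_cst 0) ff_opp ff_add.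
Proof.
move=> x; rewrite -[x]reprK !ff_oppE !ff_addE.
by apply: ratRep_eqI => a _ _ /=; rewrite mulN1r addNr.
Qed.

Lemma ff_mulA : associative ff_mul.
Proof.
move=> x y z; rewrite -[x]reprK -[y]reprK -[z]reprK !ff_mulE.
by apply: ratRep_eqI => a _ _ /=; rewrite mulrA.
Qed.

Lemma ff_mulC : commutative ff_mul.
Proof.
move=> x y; rewrite -[x]reprK -[y]reprK !ff_mulE.
by apply: ratRep_eqI => a _ _ /=; rewrite mulrC.
Qed.

Lemma ff_mul1 : left_id (ff_cst 1) ff_mul.
Proof.
move=> x; rewrite -[x]reprK !ff_mulE.
by apply: ratRep_eqI => a _ _ /=; rewrite mul1r.
Qed.

Lemma ff_mulDl : left_distributive ff_mul ff_add.
Proof.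
move=> x y z; rewrite -[x]reprK -[y]reprK -[z]reprK !(ff_addE, ff_mulE).
by apply: ratRep_eqI => a _ _ /=; rewrite mulrDl.
Qed.

Lemma ff_cst_neq (c d : k) : c != d -> ff_cst c != ff_cst d.
Proof.
apply: contra_neq => /eqP/ratRep_eqmodP[W [_ [x Wx] _ e]].
exact: (e x Wx).
Qed.

Lemma ff_oneN0 : ff_cst 1 != ff_cst 0.
Proof. by apply: ff_cst_neq; exact: oner_neq0. Qed.

HB.instance Definition _ :=
  GRing.isZmodule.Build funField ff_addA ff_addC ff_add0 ff_addN.

HB.instance Definition _ :=
  GRing.Zmodule_isComNzRing.Build funField ff_mulA ff_mulC ff_mul1 ff_mulDl
    ff_oneN0.

Lemma ff_mulV (x : funField) : x != 0 -> ff_inv x * x = 1.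
Proof.
rewrite -[x]reprK; set f := repr x => f0.
have nz : rnz f !=set0.
  apply: contrapT => nz; move/negP: f0; apply; apply/eqP.
  apply: ratRep_eqI => a fa _ /=; apply/eqP/negPn/negP => n0.
  by apply: nz; exists a.
rewrite ff_invE [LHS]ff_mulE; apply/eqP/ratRep_eqmodP.
exists (rnz f); split=> //.
- exact: rnz_open.
- by rewrite /= /rinv; case: pselect => //= _ a [fa n0].
- move=> a [fa /= n0]; rewrite rinv_val //; first by rewrite mulVf.
  by rewrite /rinv; case: pselect.
Qed.

Lemma ff_inv0 : ff_inv 0 = 0.
Proof.
rewrite [ff_inv 0]ff_invE; apply: ratRep_eqI => a fa _.
by rewrite rinv_val //= invr0.
Qed.

HB.instance Definition _ :=
  GRing.ComNzRing_isField.Build funField ff_mulV ff_inv0.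

End FunctionField.

Section RationalMaps.
Context (k : fieldType).

(* A representative of a rational map X --> Y; rational maps are considered up
   to [rmap_eq]. *)
Record ratMap (X Y : irrSpace k) := RatMap {
  mdom : set X;
  mval :> X -> Y;
  mdom_open : open mdom;
  mdom_neq0 : mdom !=set0;
  mval_morphism : morphism_on mdom mval
}.

Definition rmap_eq (X Y : irrSpace k) (f g : ratMap X Y) : Prop :=
  exists W, [/\ open W, W !=set0, W `<=` mdom f `&` mdom g
    & forall x, W x -> f x = g x].

(* The rational map f is defined at x (its domain of definition being the union
   of the domains of all its representatives) and sends x to y. *)
Definition maps_to (X Y : irrSpace k) (f : ratMap X Y) (x : X) (y : Y) : Prop :=
  exists g : ratMap X Y, [/\ rmap_eq f g, mdom g x & g x = y].

Definition dominant (X Y : irrSpace k) (f : ratMap X Y) : Prop :=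
  forall V : set Y, open V -> V !=set0 -> mdom f `&` f @^-1` V !=set0.

Section Comorphism.
Context (X Y : irrSpace k) (f : ratMap X Y) (fdom : dominant f).

Definition pullback (h : ratRep Y) : ratRep X :=
  RatRep (mval_morphism f (rdom_open h)).1 (fdom (rdom_open h) (rdom_neq0 h))
    ((mval_morphism f (rdom_open h)).2 _ (rval_regular h)).

Definition comorphism (h : funField Y) : funField X :=
  \pi_(funField X) (pullback (repr h)).

Lemma comorphismE h : comorphism (\pi_(funField Y) h) = \pi_(funField X) (pullback h).
Proof.
have [W [oW nW sW e]] := reprE h.
apply/eqP/ratRep_eqmodP; exists (mdom f `&` f @^-1` W); split.
- exact: (mval_morphism f oW).1.
- exact: fdom.
- by move=> x [fx /= /sW[? ?]]; split; split.
- by move=> x [_ /= Wx]; apply: e.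
Qed.

Lemma comorphism_zmod : zmod_morphism comorphism.
Proof.
move=> x y; rewrite -[x]reprK -[y]reprK.
rewrite [X in comorphism X](_ : _ = \pi_(funField Y) (radd (repr x) (ropp (repr y)))).
  rewrite !comorphismE [X in _ = _ + X]ff_oppE [RHS]ff_addE.
  by apply: ratRep_eqI.
by rewrite [X in _ + X]ff_oppE [LHS]ff_addE.
Qed.

Lemma comorphism_monoid : monoid_morphism comorphism.
Proof.
split; first by rewrite comorphismE; apply: ratRep_eqI.
move=> x y; rewrite -[x]reprK -[y]reprK.
rewrite [X in comorphism X](_ : _ = \pi_(funField Y) (rmul (repr x) (repr y))); last exact: ff_mulE.
by rewrite !comorphismE [RHS]ff_mulE; apply: ratRep_eqI.
Qed.

HB.instance Definition _ :=
  GRing.isZmodMorphism.Build (funField Y) (funField X) comorphism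
    comorphism_zmod.
HB.instance Definition _ :=
  GRing.isMonoidMorphism.Build (funField Y) (funField X) comorphism
    comorphism_monoid.

End Comorphism.

End RationalMaps.

Section Gm.
Context (k : fieldType).

Definition gmPt : Type := {g : k | g != 0}.
HB.instance Definition _ := Choice.on gmPt.

(* G_m as the open subspace t != 0 of the affine line with coordinate t; its
   regular functions are locally of the form p(t) / q(t). *)
Definition gmBase_pred (U : set gmPt) (f : gmPt -> k) : Prop :=
  U = setT /\ exists p : {poly k}, forall g, f g = p.[val g].

Lemma gmBase_cst c : gmBase_pred setT (fun=> c).
Proof. by split=> //; exists c%:P => g; rewrite hornerC. Qed.

Lemma gmBase_add U V f g : gmBase_pred U f -> gmBase_pred V g ->
  gmBase_pred (U `&` V) (fun x => f x + g x).
Proof.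
move=> [-> [p fE]] [-> [q gE]]; split; first by rewrite setIT.
by exists (p + q) => v; rewrite hornerD fE gE.
Qed.

Lemma gmBase_mul U V f g : gmBase_pred U f -> gmBase_pred V g ->
  gmBase_pred (U `&` V) (fun x => f x * g x).
Proof.
move=> [-> [p fE]] [-> [q gE]]; split; first by rewrite setIT.
by exists (p * q) => v; rewrite hornerM fE gE.
Qed.

Definition gmSpace : funSpace k :=
  genSpace (FunBase gmBase_cst gmBase_add gmBase_mul).

Definition gm_mul (g h : gmSpace) : gmSpace :=
  exist _ (val g * val h) (mulf_neq0 (valP g) (valP h)).

Definition gm_one : gmSpace := exist _ 1 (oner_neq0 k).

Lemma gm_coord_regular : regular [set: gmSpace] val.
Proof.
move=> g _; exists setT, val, (fun=> 1); split=> //.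
- by split=> //; exists 'X => h; rewrite hornerX.
- exact: gmBase_cst.
- exact: oner_neq0.
- by move=> h _ _ _; rewrite divr1.
Qed.

End Gm.

Section Action.
Context (k : closedFieldType).

Lemma gm_irreducible : irreducible (gmSpace k).
Proof.
split; first by exists (gm_one k).
move=> U V oU oV [g Ug] [h Vh].
have [_ [f [[-> [p fE]] _ fg sU]]] := oU g Ug.
have [_ [f' [[-> [q f'E]] _ f'h sV]]] := oV h Vh.
have p0 : p != 0 by apply: contraNneq fg => p0; rewrite fE p0 horner0.
have q0 : q != 0 by apply: contraNneq f'h => q0; rewrite f'E q0 horner0.
have pq0 : p * q != 0 by rewrite mulf_neq0.
have : size (p * q * 'X - 1) != 1%N.
  rewrite size_polyDl; first by rewrite size_mulX // eqSS size_poly_eq0.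
  by rewrite size_polyN size_poly1 size_mulX // ltnS size_poly_gt0.
case/closed_rootP => x; rewrite rootE !hornerE subr_eq0 => /eqP xE.
have : p.[x] * q.[x] * x != 0 by rewrite xE oner_neq0.
rewrite !mulf_eq0 !negb_or => /andP[/andP[px qx] x0].
exists (exist _ x x0); split.
- by apply: sU; split=> //=; rewrite fE.
- by apply: sV; split=> //=; rewrite f'E.
Qed.

Definition Gm : irrSpace k := IrrSpace gm_irreducible.

Context (X : irrSpace k).

Lemma gm_cst1 : regular [set: gmSpace k] (fun=> 1).
Proof. by apply: regular_cst; exact: openT. Qed.

Lemma pr2_base (V : set X) (h : X -> k) : open V -> regular V h ->
  prodBase_pred (X := gmSpace k) (setT `*` V) (fun z => h z.2).
Proof.
move=> oV rh; exists setT, V, [:: (fun=> 1, h)]; split=> //.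
- exact: openT.
- by move=> [|[]] // _; split=> //; exact: gm_cst1.
- by move=> z; rewrite big_seq1 mul1r.
Qed.

Lemma pr2_morphism : morphism_on (X := irrProd Gm X) (Y := X) setT snd.
Proof.
move=> V oV; have b1 := pr2_base oV (regular_cst 1 oV); split.
  move=> [g x] [_ /= Vx]; exists (setT `*` V), (fun=> 1).
  split; [exact: b1 | by split | exact: oner_neq0 |].
  by move=> z [[_ Vz] _]; split.
move=> h rh [g x] [_ /= Vx]; exists (setT `*` V), (h \o snd), (fun=> 1).
split=> //=.
- exact: (pr2_base oV rh).
- exact: oner_neq0.
- by move=> z _ _ _; rewrite divr1.
Qed.

Definition pr2 : ratMap (irrProd Gm X) X :=
  RatMap openT (irrT (irrProd Gm X)) pr2_morphism.

Lemma pr2_dominant : dominant pr2.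
Proof. by move=> V _ [x Vx]; exists (gm_one k, x). Qed.

Lemma coord_regular :
  regular [set: irrProd Gm X] (fun z => val (z.1 : gmSpace k)).
Proof.
move=> z _; exists (setT `*` setT), (fun z => val z.1), (fun=> 1); split=> //.
- exists setT, setT, [:: (val, fun=> 1)]; split=> //; do ?exact: openT.
  + move=> [|[]] // _; split; first exact: gm_coord_regular.
    by apply: regular_cst; exact: openT.
  + by move=> y; rewrite big_seq1 mulr1.
- by rewrite setXTT; exact: prodBase_cst.
- exact: oner_neq0.
- by move=> y _ _ _; rewrite divr1.
Qed.

(* K_X(t) is the function field k(G_m x X): the coordinate t is [coord_t], and
   K_X is regarded as a subfield via [from_KX], the comorphism of the second
   projection. *)
Definition coord_t : funField (irrProd Gm X) :=
  \pi_(funField (irrProd Gm X))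
    (RatRep openT (irrT (irrProd Gm X)) coord_regular).

Definition from_KX : {rmorphism funField X -> funField (irrProd Gm X)} :=
  comorphism pr2_dominant.

Context (phi : ratMap (irrProd Gm X) X).

(* Equality of rational maps is equality at all points of a nonempty open set.
   First clause: phi o (id x phi) = phi o (mu x id) on G_m x (G_m x X); second
   clause: phi o (e x id) = pr_2 on Spec(k) x X = X. *)
Definition rational_action : Prop :=
  (exists W : set (irrProd Gm (irrProd Gm X)), [/\ open W, W !=set0 &
     forall (g h : Gm) (x : X), W (g, (h, x)) -> exists y z : X,
       [/\ maps_to phi (h, x) y, maps_to phi (g, y) z
         & maps_to phi (gm_mul g h, x) z]]) /\
  (exists U : set X, [/\ open U, U !=set0 &
     forall x, U x -> maps_to phi (gm_one k, x) x]).

(* phi_g = phi_h as rational maps, where phi_g : x |-> phi (g, x) *)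
Definition same_fiber_map (g h : Gm) : Prop :=
  exists U : set X, [/\ open U, U !=set0 &
    forall x, U x -> exists y, maps_to phi (g, x) y /\ maps_to phi (h, x) y].

(* injectivity of g |-> phi_g *)
Definition faithful : Prop :=
  forall g h : Gm, same_fiber_map g h -> g = h.

Lemma rational_action_dominant : rational_action -> dominant phi.
Proof.
move=> [_ [U [oU nU actU]]] V oV nV.
have [x [Ux Vx]] := irrI oU oV nU nV.
have [f [[W [oW nW sW e]] fx fxE]] := actU x Ux.
have [z [Wz [fz Vfz]]] : W `&` (mdom f `&` f @^-1` V) !=set0.
  apply: irrI => //; first exact: (mval_morphism f oV).1.
  by exists (gm_one k, x); split=> //=; rewrite fxE.
by exists z; split; [have [] := sW z Wz | rewrite /= e].
Qed.

Definition action_comorphism (act : rational_action) :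
    {rmorphism funField X -> funField (irrProd Gm X)} :=
  comorphism (rational_action_dominant act).

End Action.

(* Main.v *)
(* Let K = K_X and write t for the coordinate of G_m.  For F in K, the function
   phi^* F in K(t) is a fraction P(t) / Q(t) in lowest terms with Q monic, say of
   degree m.  Associativity of the action, phi(g, phi(h, x)) = phi(g h, x), says
   that applying phi^* to the coefficients of P / Q has the same effect as
   replacing the variable T by t T; uniqueness of reduced fractions then gives
   phi^* q_j = t^(j - m) q_j and phi^* p_j = t^(j - m) p_j, so all nonzero
   coefficients are semi-invariants.  The weights of semi-invariants form a
   subgroup of Z.  If 1 is not a weight, all weights are divisible by some d > 1;
   for a d-th root of unity zeta <> 1 the functions P / Q, hence the coordinates
   of phi(g, x) in an affine chart, do not change when g is replaced by g zeta,
   against faithfulness. *)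
Require Import Defs.
From HB Require Import structures.
From mathcomp Require mpoly.
From mathcomp Require Import all_boot all_order all_algebra.
From mathcomp Require Import generic_quotient.
From mathcomp Require Import boolp classical_sets topology.

Import GRing.Theory.
Local Open Scope ring_scope.
Local Open Scope classical_set_scope.
Local Open Scope quotient_scope.

Set Implicit Arguments.
Unset Strict Implicit.

(** * Fractions, subgroups of Z and roots of unity *)

Lemma coef_comp_polyZX (R : comNzRingType) (p : {poly R}) (a : R) i :
  (p \Po (a *: 'X))`_i = p`_i * a ^+ i.
Proof.
rewrite comp_polyE coef_sum; under eq_bigr => j _.
  by rewrite coefZ exprZn coefZ coefXn; over.
have [ip|pi] := ltnP i (size p).
  rewrite (bigD1 (Ordinal ip)) //= eqxx mulr1 big1 ?addr0 // => j ji.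
  rewrite (_ : (i == j) = false) ?mulr0 //.
  by apply: contra_neqF ji => /eqP ij; exact: val_inj.
rewrite [p`_i]nth_default // mul0r big1 // => j _.
rewrite (_ : (i == j) = false) ?mulr0 //.
by apply/eqP => ij; move: (ltn_ord j); rewrite -ij ltnNge pi.
Qed.

(* Reduced fractions with monic denominator are unique, so both sides of the
   cross-multiplied identity agree coefficientwise after rescaling by t^m. *)
Lemma monic_fraction_coefs (K L : fieldType) (f i : {rmorphism K -> L}) (t : L)
    (P Q : {poly K}) : t != 0 -> coprimep P Q -> Q \is monic ->
  map_poly f Q * (map_poly i P \Po (t *: 'X)) =
    map_poly f P * (map_poly i Q \Po (t *: 'X)) ->
  forall j, i Q`_j * t ^+ j = t ^+ (size Q).-1 * f Q`_j /\
            i P`_j * t ^+ j = t ^+ (size Q).-1 * f P`_j.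
Proof.
move=> t0 cPQ mQ e; set m := (size Q).-1.
set Q1 := map_poly f Q in e; set P1 := map_poly f P in e.
set Q2 := map_poly i Q \Po _ in e; set P2 := map_poly i P \Po _ in e.
have c1 : coprimep P1 Q1 by rewrite coprimep_map.
have c2 : coprimep P2 Q2 by rewrite coprimep_comp_poly // coprimep_map.
have Q1dQ2 : Q1 %| Q2.
  by rewrite -(@Gauss_dvdpr _ Q2 P1) -?e ?dvdp_mulr // coprimep_sym.
have Q2dQ1 : Q2 %| Q1.
  by rewrite -(@Gauss_dvdpl _ Q1 P2) ?e ?dvdp_mull // coprimep_sym.
have mQ1 : Q1 \is monic by rewrite map_monic.
have Q2E : Q2 = lead_coef Q2 *: Q1.
  by rewrite [LHS](@eqpfP _ Q2 Q1) /eqp ?Q1dQ2 ?Q2dQ1 // (monicP mQ1) divr1.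
(* At index [m] the coefficient of [Q] is 1, so comparing there gives [t ^+ m] on the left and the
   scalar itself on the right. *)
have lE : lead_coef Q2 = t ^+ m.
  have := congr1 (fun p : {poly L} => p`_m) Q2E.
  rewrite coefZ /Q1 /Q2 coef_comp_polyZX !coef_map /=.
  rewrite (_ : Q`_m = 1); last exact/eqP.
  by rewrite !rmorph1 mul1r mulr1.
have P2E : P2 = t ^+ m *: P1.
  apply: (mulfI (monic_neq0 mQ1)); rewrite e Q2E lE.
  by rewrite -!scalerAr mulrC.
move=> j; split.
  have := congr1 (fun p : {poly L} => p`_j) Q2E.
  by rewrite lE coefZ coef_comp_polyZX !coef_map.
have := congr1 (fun p : {poly L} => p`_j) P2E.
by rewrite coefZ coef_comp_polyZX !coef_map.
Qed.

(** Take for [d] the least positive element: Euclidean division leaves a remainder in [S] below [d],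
    hence 0. Without positive elements [S] contains only 0, and [d] = 2 serves. *)
Lemma int_subgroup_dvd (S : int -> Prop) : S 0 -> (forall m n, S m -> S n -> S (m - n)) ->
  ~ S 1 -> exists2 d : nat, (1 < d)%N & forall n, S n -> (d %| n)%Z.
Proof.
move=> S0 SB S1.
have SN n : S n -> S (- n) by move=> Sn; rewrite -sub0r; exact: SB.
have SD m n : S m -> S n -> S (m + n) by move=> Sm /SN Sn; rewrite -[n]opprK; exact: SB.
have [[n /andP[n0 /asboolP Sn]]|noS] :=
  pselect (exists n, (0 < n)%N && `[< S n%:Z >]); last first.
  exists 2%N => // -[n|n] Sn; last first.
    by case: noS; exists n.+1; apply/asboolP; move: Sn => /SN; rewrite NegzE opprK.
  by case: n Sn => [|n] Sn; [exact: dvdz0 | case: noS; exists n.+1; exact/asboolP].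
have exd : exists n, (0 < n)%N && `[< S n%:Z >] by exists n; rewrite n0; exact/asboolP.
have [d /andP[d0 /asboolP Sd] dmin] := ex_minnP exd.
have SM i : S (d%:Z *+ i).
  by elim: i => [|i IH]; rewrite ?mulr0n // mulrS; exact: SD.
have SMz (z : int) : S (z * d%:Z).
  have SMn i : S (i%:Z * d%:Z) by have := SM i; rewrite -mulr_natr natz mulrC.
  by case: z => i; rewrite ?NegzE ?mulNr; [|apply: SN]; exact: SMn.
exists d.
  by case: d d0 Sd {dmin SM SMz} => [|[|d]].
move=> z Sz; apply/dvdz_mod0P.
have Sr : S (z %% d)%Z by rewrite /modz; exact: SB.
have r0 : (0 <= z %% d)%Z by rewrite modz_ge0 // -lt0n.
have rd : (z %% d < d%:Z)%Z by rewrite ltz_pmod.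
case: (z %% d)%Z Sr r0 rd => // -[|r] // Sr _ rd.
have := dmin r.+1; rewrite /=.
by move=> /(_ (asboolT Sr)); rewrite leqNgt; case/negP.
Qed.

(** [zeta] is a root of 1 + X + ... + X^(d-1), whose value [d] at 1 is nonzero in characteristic
    zero. *)
Lemma nontrivial_root_of_unity (k : closedFieldType) d : [pchar k] =i pred0 ->
  (1 < d)%N -> exists2 zeta : k, zeta != 1 & zeta ^+ d = 1.
Proof.
move=> /pcharf0P k0 d1; pose p : {poly k} := \poly_(i < d) 1.
have sp : size p != 1%N.
  by rewrite size_poly_eq ?oner_neq0 //; case: d d1 {p} => [|[]].
have [z /rootP] := closed_rootP _ sp; rewrite horner_poly => z0; exists z.
  apply: contra_eq_neq z0 => ->; under eq_bigr do rewrite mul1r expr1n.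
  by rewrite sumr_const card_ord k0 -lt0n ltnW.
apply/eqP; rewrite -subr_eq0 subrX1; move: z0; under eq_bigr do rewrite mul1r.
by move=> ->; rewrite mulr0.
Qed.

(** * Generic points *)

(** Irreducibility makes this a proper filter, so that properties holding on nonempty open sets can
    be combined with the [near] tactics. *)
Definition generic (k : fieldType) (X : irrSpace k) : set_system X :=
  [set P | exists W, [/\ open W, W !=set0 & W `<=` P]].

Arguments generic {k} X _.

#[global] Instance generic_proper_filter (k : fieldType) (X : irrSpace k) :
  ProperFilter (generic X).
Proof.
apply: Build_ProperFilter_ex => [P [W [_ [x Wx] sW]]|]; first by exists x; exact: sW.
constructor.
- by exists setT; split=> //; [exact: openT | exact: irrT].
- move=> P Q [U [oU nU sU]] [V [oV nV sV]]; exists (U `&` V); split.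
  + exact: openI.
  + exact: irrI.
  + by move=> x [/sU Px /sV Qx].
- move=> P Q sPQ [U [oU nU sU]]; exists U; split=> //.
  exact: subset_trans sPQ.
Qed.

(* Instance search is syntactic and fails when the carrier of [X] was unfolded
   (e.g. from [Gm k] to [gmPt k]). *)
#[local] Hint Extern 0 (Filter _) =>
  match goal with |- context [@generic ?k ?X] =>
    exact (@filter_filter _ _ (@generic_proper_filter k X)) end : typeclass_instances.
#[local] Hint Extern 0 (ProperFilter _) =>
  match goal with |- context [@generic ?k ?X] =>
    exact (@generic_proper_filter k X) end : typeclass_instances.

Lemma genericP (k : fieldType) (X : irrSpace k) (P : set X) :
  (\forall x \near generic X, P x) <->
  exists W, [/\ open W, W !=set0 & forall x, W x -> P x].
Proof. exact: conj id id. Qed.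

(* The value of a rational function at a point, generically; the zero function
   is given the value 0 everywhere so that [map_poly (ffval x)] is well behaved. *)
Definition ffval (k : fieldType) (X : irrSpace k) (x : X) (F : funField X) : k :=
  if F == 0 then 0 else rval (repr F) x.

Section Ffval.
Context (k : fieldType) (X : irrSpace k).
Implicit Types (F G : funField X) (x : X).

Lemma ffval0 x : ffval x 0 = 0.
Proof. by rewrite /ffval eqxx. Qed.

Lemma ffval_pi (f : ratRep X) :
  \forall x \near generic X, ffval x (\pi_(funField X) f) = rval f x.
Proof.
rewrite /ffval; case: eqP => [f0|_].
  have /eqP/ratRep_eqmodP[W [oW nW _ e]] : \pi_(funField X) (rcst X 0) = \pi_(funField X) f.
    by rewrite f0.
  by apply/genericP; exists W; split=> // x Wx; rewrite -e.
by have [W [oW nW _ e]] := reprE f; apply/genericP; exists W.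
Qed.

Lemma ffval_eq F G :
  (\forall x \near generic X, ffval x F = ffval x G) -> F = G.
Proof.
rewrite -[F]reprK -[G]reprK; set f := repr F; set g := repr G => eFG.
have e : \forall x \near generic X, rval f x = rval g x.
  by apply: filterS3 eFG (ffval_pi f) (ffval_pi g) => x -> <- <-.
have /genericP[W [oW nW sW]] := e; apply/eqP/ratRep_eqmodP.
exists (W `&` (rdom f `&` rdom g)); split.
- by apply: openI => //; exact: rI_open.
- by apply: irrI => //; [exact: rI_open | exact: rI_neq0].
- by move=> x [].
- by move=> x [/sW].
Qed.

Lemma ffval_repr F : \forall x \near generic X, ffval x F = rval (repr F) x.
Proof. by have := ffval_pi (repr F); rewrite reprK. Qed.

Lemma ffvalD F G :
  \forall x \near generic X, ffval x (F + G) = ffval x F + ffval x G.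
Proof.
have -> : F + G = \pi_(funField X) (radd (repr F) (repr G)).
  by rewrite -{1}[F]reprK -{1}[G]reprK; exact: ff_addE.
apply: filterS3 (ffval_repr F) (ffval_repr G) (ffval_pi (radd (repr F) (repr G))).
by move=> x -> -> ->.
Qed.

Lemma ffvalM F G :
  \forall x \near generic X, ffval x (F * G) = ffval x F * ffval x G.
Proof.
have -> : F * G = \pi_(funField X) (rmul (repr F) (repr G)).
  by rewrite -{1}[F]reprK -{1}[G]reprK; exact: ff_mulE.
apply: filterS3 (ffval_repr F) (ffval_repr G) (ffval_pi (rmul (repr F) (repr G))).
by move=> x -> -> ->.
Qed.

Lemma ffval_cst c : \forall x \near generic X, ffval x (ff_cst X c) = c.
Proof. exact: (ffval_pi (rcst X c)). Qed.

Lemma ffvalX F n : \forall x \near generic X, ffval x (F ^+ n) = ffval x F ^+ n.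
Proof.
elim: n => [|n IHn]; first by apply: filterS (ffval_cst 1).
by rewrite exprS; apply: filterS2 (ffvalM F (F ^+ n)) IHn => x ->; rewrite exprS => ->.
Qed.

Lemma ffval_neq0 F : F != 0 -> \forall x \near generic X, ffval x F != 0.
Proof.
move=> F0; have := ffvalM F F^-1; rewrite divff // => e.
apply: filterS2 e (ffval_cst 1) => x + e1; rewrite [ffval x 1]e1 => /esym FV.
by apply: contra_eq_neq FV => ->; rewrite mul0r eq_sym oner_neq0.
Qed.

Lemma ffval_sum (I : Type) (r : seq I) (F : I -> funField X) :
  \forall x \near generic X, ffval x (\sum_(i <- r) F i) = \sum_(i <- r) ffval x (F i).
Proof.
elim: r => [|i r IH].
  by apply: nearW => x; rewrite !big_nil ffval0.
apply: filterS2 IH (ffvalD (F i) (\sum_(j <- r) F j)) => x e1 e2.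
by rewrite !big_cons e2 e1.
Qed.

Lemma ffval_horner (A : {poly funField X}) (T : funField X) :
  \forall x \near generic X, ffval x A.[T] = (map_poly (ffval x) A).[ffval x T].
Proof.
rewrite horner_coef.
have H : \forall x \near generic X, forall i : 'I_(size A),
    ffval x (A`_i * T ^+ i) = ffval x A`_i * ffval x T ^+ i.
  apply: filter_forall => i.
  by apply: filterS2 (ffvalM A`_i (T ^+ i)) (ffvalX T i) => x -> ->.
apply: filterS2 H (ffval_sum (index_enum 'I_(size A)) (fun i => A`_i * T ^+ i)) => x H ->.
rewrite (@horner_coef_wide _ (size A)) ?size_poly //.
by apply: eq_bigr => i _; rewrite coef_map_id0 ?ffval0 // H.
Qed.

End Ffval.

(** * Pullback along dominant maps and generic slices of products *)

Lemma comorphism_ffval (k : fieldType) (X Y : irrSpace k) (f : ratMap X Y)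
    (fdom : dominant f) (F : funField Y) :
  \forall x \near generic X, ffval x (comorphism fdom F) = ffval (f x) F.
Proof.
have /genericP[W [oW nW sW]] := ffval_pi (repr F).
have e' : \forall x \near generic X, ffval (f x) F = rval (repr F) (f x).
  apply/genericP; exists (mdom f `&` f @^-1` W); split.
  - exact: (mval_morphism f oW).1.
  - exact: fdom.
  - by move=> x [_ /= /sW]; rewrite reprK.
rewrite {1}/comorphism.
by apply: filterS2 (ffval_pi (pullback fdom (repr F))) e' => x -> ->.
Qed.

Lemma near_dominant (k : fieldType) (X Y : irrSpace k) (f : ratMap X Y)
    (fdom : dominant f) (P : set Y) :
  (\forall y \near generic Y, P y) -> \forall x \near generic X, P (f x).
Proof.
move=> /genericP[W [oW nW sW]]; apply/genericP; exists (mdom f `&` f @^-1` W); split.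
- exact: (mval_morphism f oW).1.
- exact: fdom.
- by move=> x [_ /= /sW].
Qed.

Section Slices.
Context (k : fieldType) (X Y : irrSpace k) (P : set (irrProd X Y)).

(** Slicing the open set at one of its points (x0, y0) by x = x0 gives the open set of good y; for
    each of them the slice in x is open and contains x0. *)
Lemma near_slicer : (\forall z \near generic (irrProd X Y), P z) ->
  \forall y \near generic Y, \forall x \near generic X, P (x, y).
Proof.
move=> /genericP[W [oW [[x0 y0] W0] sW]].
apply/genericP; exists [set y | W (x0, y)]; split; [exact: prod_slicer | by exists y0 |].
move=> y /= Wy; apply/genericP; exists [set x | W (x, y)]; split; first exact: prod_slicel.
  by exists x0.
by move=> x /= /sW.
Qed.

Lemma near_slicel : (\forall z \near generic (irrProd X Y), P z) ->
  \forall x \near generic X, \forall y \near generic Y, P (x, y).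
Proof.
move=> /genericP[W [oW [[x0 y0] W0] sW]].
apply/genericP; exists [set x | W (x, y0)]; split; [exact: prod_slicel | by exists x0 |].
move=> x /= Wx; apply/genericP; exists [set y | W (x, y)]; split; first exact: prod_slicer.
  by exists y0.
by move=> y /= /sW.
Qed.

End Slices.

(* The hypothesis is weaker than equality for generic pairs: a set containing
   generic x for generic y need not contain a nonempty open set. *)
Lemma ffval_eq2 (k : fieldType) (X Y : irrSpace k) (F G : funField (irrProd X Y)) :
  (\forall y \near generic Y, \forall x \near generic X,
     ffval ((x, y) : irrProd X Y) F = ffval ((x, y) : irrProd X Y) G) -> F = G.
Proof.
move=> e; apply/eqP; rewrite -subr_eq0; apply: contraT => FG.
(* A nonzero [F - G] would be nonzero at a generic point of a generic slice, where [F] and [G] have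
   the same value. *)
have [y [ey [ny Dy]]] := filter_ex (filterI e (filterI
  (near_slicer (ffval_neq0 FG)) (near_slicer (ffvalD (F - G) G)))).
have [x [ex [/eqP nx Dx]]] := filter_ex (filterI ey (filterI ny Dy)).
by case: nx; apply: (addIr (ffval ((x, y) : irrProd X Y) G)); rewrite -Dx subrK ex add0r.
Qed.

(** Here [rho] is a bare function, so composites such as a projection followed by [phi] need not be
    packaged as a [ratMap]. *)
Lemma ffval_map_horner (k : fieldType) (X Z : irrSpace k) (rho : Z -> X)
    (sigma : {rmorphism funField X -> funField Z})
    (sigmaE : forall F, \forall z \near generic Z, ffval z (sigma F) = ffval (rho z) F)
    (A : {poly funField X}) (T : funField Z) :
  \forall z \near generic Z, ffval z (map_poly sigma A).[T] =
    (map_poly (ffval (rho z)) A).[ffval z T].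
Proof.
have H : \forall z \near generic Z, forall i : 'I_(size A),
    ffval z (sigma A`_i) = ffval (rho z) A`_i.
  by apply: filter_forall => i; exact: sigmaE.
apply: filterS2 H (ffval_horner (map_poly sigma A) T) => z H ->; congr (_.[_]).
apply/polyP => i; rewrite !coef_map_id0 ?ffval0 ?rmorph0 //.
have [iA|Ai] := ltnP i (size A); first exact: (H (Ordinal iA)).
by rewrite nth_default // rmorph0 !ffval0.
Qed.

(** * Functions on G_m x X *)

Section GmGeneric.
Context (k : closedFieldType).
Implicit Type P : set (Gm k).

Definition gm_val (g : Gm k) : k := val (g : gmSpace k).

Lemma generic_GmP P : (\forall g \near generic (Gm k), P g) <->
  exists2 r : {poly k}, r != 0 & forall g : Gm k, r.[gm_val g] != 0 -> P g.
Proof.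
split=> [/genericP[W [oW [g0 Wg0] sW]]|[r r0 rP]].
  have [_ [f [[-> [r fE]] _ f0 sf]]] := oW g0 Wg0; exists r.
    by apply: contra_neq f0 => r0; rewrite fE r0 horner0.
  by move=> g rg; apply: sW; apply: sf; split=> //=; rewrite fE.
apply/genericP; exists [set g : Gm k | r.[gm_val g] != 0]; split=> //.
  move=> g /= rg; exists setT, (fun h => r.[gm_val h]); split=> //.
    by split=> //; exists r.
(* The factor 'X forces the point where [r] does not vanish to be nonzero, hence in G_m. *)
have /closed_nonrootP[x] : r * 'X != 0 by rewrite mulf_neq0 // polyX_eq0.
rewrite rootE hornerM hornerX mulf_eq0 negb_or => /andP[rx x0].
by exists (exist _ x x0 : gmSpace k); exact: rx.
Qed.

Lemma generic_Gm_mulr P (h : Gm k) : (\forall g \near generic (Gm k), P g) ->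
  \forall g \near generic (Gm k), P (gm_mul g h).
Proof.
(* Since [h] is nonzero, substituting hX for X preserves the degree of [r]. *)
move=> /generic_GmP[r r0 rP]; apply/generic_GmP; exists (r \Po (gm_val h *: 'X)).
  rewrite -size_poly_eq0 size_comp_poly2 ?size_poly_eq0 //.
  by rewrite size_scale ?size_polyX //; exact: (valP (h : gmSpace k)).
by move=> g; rewrite horner_comp hornerZ hornerX mulrC => rg; exact: rP.
Qed.

Lemma generic_Gm_poly0 (p : {poly k}) :
  (\forall g \near generic (Gm k), p.[gm_val g] = 0) -> p = 0.
Proof.
move=> p0; apply/eqP; apply: contraT => nz.
have np : \forall g \near generic (Gm k), p.[gm_val g] != 0.
  by apply/generic_GmP; exists p.
by have [g [g0 /eqP]] := filter_ex (filterI p0 np).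
Qed.

Context (X : irrSpace k).

Lemma ffval_coord_t : \forall z \near generic (irrProd (Gm k) X),
  ffval z (coord_t X) = gm_val z.1.
Proof. exact: ffval_pi. Qed.

Lemma ffval_from_KX F : \forall z \near generic (irrProd (Gm k) X),
  ffval z (from_KX X F) = ffval z.2 F.
Proof. exact: (comorphism_ffval (@pr2_dominant k X)). Qed.

Lemma ffval_KX_poly (A : {poly funField X}) : \forall z \near generic (irrProd (Gm k) X),
  ffval z (map_poly (from_KX X) A).[coord_t X] =
    (map_poly (ffval z.2) A).[gm_val z.1].
Proof.
apply: filterS2 ffval_coord_t (ffval_map_horner ffval_from_KX A (coord_t X)).
by move=> z -> ->.
Qed.

(** For generic x, the polynomial over [k] obtained by evaluating the coefficients at x vanishes at
    generic g, hence is zero; so each coefficient vanishes at generic x. *)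
Lemma coord_t_transcendental (A : {poly funField X}) :
  (map_poly (from_KX X) A).[coord_t X] = 0 -> A = 0.
Proof.
move=> A0; have := near_slicer (ffval_KX_poly A); rewrite A0 => e.
apply/polyP => i; rewrite coef0; apply: ffval_eq.
apply: filterS e => x /= e; rewrite ffval0 -coef_map_id0 ?ffval0 //.
suff -> : map_poly (ffval x) A = 0 by rewrite coef0.
by apply: generic_Gm_poly0; apply: filterS e => g <-; rewrite ffval0.
Qed.

End GmGeneric.

Lemma near_fst (k : fieldType) (X Y : irrSpace k) (P : set X) :
  (\forall x \near generic X, P x) -> \forall z \near generic (irrProd X Y), P z.1.
Proof.
move=> /genericP[W [oW [x0 Wx0] sW]]; have [y0 _] := irrT Y; apply/genericP.
exists (W `*` setT); split; [|by exists (x0, y0)|by move=> z [/sW]].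
move=> z [Wz _]; exists (W `*` setT), (fun=> 1); split=> //; last exact: oner_neq0.
exists W, setT, [:: (fun=> 1, fun=> 1)]; split=> //; first exact: openT.
  by move=> [|[]] // _; split; apply: regular_cst => //; exact: openT.
by move=> y; rewrite big_seq1 mulr1.
Qed.

(** * Rational functions on G_m x X are fractions in t over K_X *)

Section RationalInT.
Context (k : closedFieldType) (X : irrSpace k).
Local Notation L := (funField (irrProd (Gm k) X)).
Local Notation iota := (from_KX X).
Local Notation t := (coord_t X).

(** Membership in the subfield generated by K_X and t, with the denominator cleared;
    [rational_in_tP] shows that this subfield is the whole function field. *)
Definition rational_in_t (F : L) : Prop := exists P Q : {poly funField X},
  (map_poly iota Q).[t] != 0 /\ F * (map_poly iota Q).[t] = (map_poly iota P).[t].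

Lemma rational_in_t_horner (P : {poly funField X}) :
  rational_in_t (map_poly iota P).[t].
Proof. by exists P, 1; rewrite rmorph1 hornerC mulr1 oner_neq0. Qed.

Lemma rational_in_t_from_KX (a : funField X) : rational_in_t (iota a).
Proof. by have := rational_in_t_horner a%:P; rewrite map_polyC hornerC. Qed.

Lemma rational_in_t_add F G : rational_in_t F -> rational_in_t G -> rational_in_t (F + G).
Proof.
move=> [P [Q [Q0 e]]] [P' [Q' [Q'0 e']]]; exists (P * Q' + P' * Q), (Q * Q').
rewrite rmorphD !rmorphM /= hornerD !hornerM mulf_neq0 //; split=> //.
by rewrite -e -e' mulrDl mulrA; congr (_ + _); rewrite mulrAC -mulrA.
Qed.

Lemma rational_in_t_mul F G : rational_in_t F -> rational_in_t G -> rational_in_t (F * G).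
Proof.
move=> [P [Q [Q0 e]]] [P' [Q' [Q'0 e']]]; exists (P * P'), (Q * Q').
by rewrite !rmorphM /= !hornerM mulf_neq0 // -e -e' mulrACA.
Qed.

Lemma rational_in_t_inv F : rational_in_t F -> rational_in_t F^-1.
Proof.
have [->|F0] := eqVneq F 0; first by rewrite invr0.
move=> [P [Q [Q0 e]]]; exists Q, P; rewrite -e mulf_neq0 //; split=> //.
by rewrite mulKf.
Qed.

Lemma ffval_cst_poly (p : {poly k}) : \forall z \near generic (irrProd (Gm k) X),
  ffval z (map_poly iota (map_poly (ff_cst X) p)).[t] = p.[gm_val z.1].
Proof.
have H : \forall x \near generic X, map_poly (ffval x) (map_poly (ff_cst X) p) = p.
  have : \forall x \near generic X, forall i : 'I_(size p), ffval x (ff_cst X p`_i) = p`_i.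
    by apply: filter_forall => i; exact: ffval_cst.
  apply: filterS => x H; apply/polyP => i; rewrite !coef_map_id0 ?ffval0 //.
  have [ip|pi] := ltnP i (size p); first exact: (H (Ordinal ip)).
  by rewrite nth_default // ffval0.
apply: filterS2 (near_dominant (@pr2_dominant k X) H)
  (ffval_KX_poly (map_poly (ff_cst X) p)).
by move=> z /= -> ->.
Qed.

(** Near one point of [U] the function [f] is a quotient p / q of polynomials over [k], whose
    coefficients are read as constants of K_X. *)
Lemma rational_in_t_fst (U : set (Gm k)) (f : Gm k -> k) :
  open U -> U !=set0 -> regular U f ->
  exists2 B, rational_in_t B &
    \forall z \near generic (irrProd (Gm k) X), ffval z B = f z.1.
Proof.
move=> oU [g0 Ug0] /(_ g0 Ug0)[V [a [b [[-> [p pE]] [_ [q qE]] _ q0 e]]]].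
pose C r := (map_poly iota (map_poly (ff_cst X) r)).[t].
exists (C p / C q).
  apply: rational_in_t_mul; first exact: rational_in_t_horner.
  by apply: rational_in_t_inv; exact: rational_in_t_horner.
have nq : \forall z \near generic (irrProd (Gm k) X), q.[gm_val z.1] != 0.
  apply: (near_fst X (P := fun g => q.[gm_val g] != 0)); apply/generic_GmP; exists q => //.
  by apply: contra_neq q0 => q0; rewrite qE q0 horner0.
have nU : \forall z \near generic (irrProd (Gm k) X), U z.1.
  by apply: (near_fst X (P := U)); apply/genericP; exists U; split=> //; exists g0.
near=> z.
have Cq : ffval z (C q) = q.[gm_val z.1] by near: z; exact: ffval_cst_poly.
have Cp : ffval z (C p) = p.[gm_val z.1] by near: z; exact: ffval_cst_poly.
have q0z : q.[gm_val z.1] != 0 by near: z.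
have Uz : U z.1 by near: z.
have CV : ffval z (C p / C q * C q) = ffval z (C p / C q) * ffval z (C q).
  by near: z; exact: ffvalM.
rewrite (e z.1 Uz) //; last by rewrite qE.
rewrite pE qE; apply: (canRL (mulfK q0z)).
move: CV; rewrite divfK ?Cp ?Cq //.
(* If [C q] were 0, its value at [z] would be 0 by the convention in [ffval], whereas it is the
   nonzero q(g). *)
by apply: contra_neq q0z => C0; rewrite -[LHS]Cq C0 ffval0.
Unshelve. all: by end_near.
Qed.

(** The function [b] is a sum of products of a function of g, rational in t by [rational_in_t_fst],
    and a function of x, which is an element of K_X. *)
Lemma rational_in_t_prodBase (W : set (Gm k * X)%type) b :
  W !=set0 -> prodBase_pred W b ->
  exists2 B, rational_in_t B & \forall z \near generic (irrProd (Gm k) X), ffval z B = b z.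
Proof.
move=> [[g0 x0] W0] [U [V [s [oU oV WE rs bE]]]].
move: W0; rewrite WE => -[/= Ug0 Vx0].
suff [B rB e] : exists2 B, rational_in_t B & \forall z \near generic (irrProd (Gm k) X),
    ffval z B = \sum_(p <- s) p.1 z.1 * p.2 z.2.
  by exists B => //; apply: filterS e => z ->; rewrite bE.
elim: s rs {bE} => [|p s IH] rs.
  exists 0; first by rewrite -(rmorph0 iota); exact: rational_in_t_from_KX.
  by apply: nearW => z; rewrite big_nil ffval0.
have [r1 r2] := rs 0%N isT.
have [B rB e] := IH (fun j => rs j.+1).
have [|A rA eA] := rational_in_t_fst oU _ r1; first by exists g0.
have nV : V !=set0 by exists x0.
pose G := \pi_(funField X) (RatRep oV nV r2).
exists (A * iota G + B).
  apply: rational_in_t_add rB; apply: rational_in_t_mul => //.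
  exact: rational_in_t_from_KX.
have eG : \forall x \near generic X, ffval x G = p.2 x by exact: ffval_pi.
near=> z; rewrite big_cons.
have <- : ffval z B = \sum_(p <- s) p.1 z.1 * p.2 z.2 by near: z.
have <- : ffval z A = p.1 z.1 by near: z.
have <- : ffval z.2 G = p.2 z.2 by near: z; exact: (near_dominant (@pr2_dominant k X) eG).
have <- : ffval z (iota G) = ffval z.2 G by near: z; exact: ffval_from_KX.
have <- : ffval z (A * iota G) = ffval z A * ffval z (iota G) by near: z; exact: ffvalM.
by near: z; exact: ffvalD.
Unshelve. all: by end_near.
Qed.

(** Near a point of its domain, a rational function is a quotient of two functions of the base of
    the product, and both are rational in t. *)
Lemma rational_in_tP (F : L) : rational_in_t F.
Proof.
have [z0 rz0] := rdom_neq0 (repr F).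
have [W [f [g [Ff Fg Wz0 g0 e]]]] := rval_regular (repr F) z0 rz0.
have nW : W !=set0 by exists z0.
have [Bf rf ef] := rational_in_t_prodBase nW Ff.
have [Bg rg eg] := rational_in_t_prodBase nW Fg.
have near_gW : \forall z \near generic (irrProd (Gm k) X), g z != 0 /\ W z.
  apply/genericP; exists (W `&` [set z | g z != 0]); split.
  - by move=> z [Wz gz]; exists W, g; split=> //; exact: subset_refl.
  - by exists z0.
  - by move=> z [].
have Bg0 : Bg != 0.
  apply/negP => /eqP B0.
  have [z [[/eqP gz _] ez]] := filter_ex (filterI near_gW eg).
  by apply: gz; rewrite -ez B0 ffval0.
suff -> : F = Bf / Bg by apply: rational_in_t_mul => //; exact: rational_in_t_inv.
apply: (canRL (mulfK Bg0)); apply: ffval_eq.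
have near_dom : \forall z \near generic (irrProd (Gm k) X), rdom (repr F) z.
  apply/genericP; exists (rdom (repr F)).
  by split=> //; [exact: rdom_open | exact: rdom_neq0].
near=> z.
have [gz Wz] : g z != 0 /\ W z by near: z.
have -> : ffval z (F * Bg) = ffval z F * ffval z Bg by near: z; exact: ffvalM.
have -> : ffval z F = rval (repr F) z by near: z; exact: ffval_repr.
have -> : ffval z Bg = g z by near: z.
have -> : ffval z Bf = f z by near: z.
rewrite e //; first by rewrite divfK.
by near: z.
Unshelve. all: by end_near.
Qed.

End RationalInT.

(** * Semi-invariant coefficients *)

(** If the values differed at [z], they would differ on a neighbourhood of [z], the diagonal being
    closed; by irreducibility this neighbourhood meets the open set where the maps agree. *)
Lemma separated_rmap_eq (k : fieldType) (Z X : irrSpace k) (sepX : Defs.separated X)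
    (f g : ratMap Z X) : rmap_eq f g ->
  forall z, mdom f z -> mdom g z -> f z = g z.
Proof.
move=> [W [oW nW sW eW]] z fz gz; apply: contrapT => nfg.
have /= := closed_openC sepX; rewrite prod_openP => /(_ (f z, g z) nfg).
move=> [_ [h [[U [V [s [oU oV -> rs hE]]]] [/= Ufz Vgz] h0 sO]]].
have [oDf rDf] := mval_morphism f oU; have [oDg rDg] := mval_morphism g oV.
set D := (mdom f `&` f @^-1` U) `&` (mdom g `&` g @^-1` V).
have oD : open D by exact: openI.
(* The pullback along (f, g) of the function [h] whose nonvanishing cuts out a neighbourhood of (f
   z, g z) off the diagonal. *)
have rD : regular D (fun x => \sum_(p <- s) p.1 (f x) * p.2 (g x)).
  apply: (regular_sum (F := fun p x => p.1 (f x) * p.2 (g x))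
    (z := (fun=> 0, fun=> 0)) oD) => i /rs[r1 r2].
  apply: (regular_mul oD).
    exact: (regular_restr oDf oD (@subIsetl _ _ _) (rDf _ r1)).
  exact: (regular_restr oDg oD (@subIsetr _ _ _) (rDg _ r2)).
have oN := regular_neq0 oD rD.
have [|x [Wx [[[_ Ufx] [_ Vgx]] nx]]] := irrI oW oN nW.
  by exists z; split; [split|rewrite /= -(hE (f z, g z))].
by apply: (sO (f x, g x)); [split=> //; rewrite /= hE|exact: eW].
Qed.

Section Homogeneity.
Context (k : closedFieldType) (X : irrSpace k) (sepX : Defs.separated X).
Context (phi : ratMap (irrProd (Gm k) X) X) (act : rational_action phi).
Local Notation Y := (irrProd (Gm k) X).
Local Notation phis := (action_comorphism act).
Local Notation iota := (from_KX X).
Local Notation t := (coord_t X).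

(** [maps_to] allows any representative of the rational map; this returns to the values of [phi]
    itself. *)
Lemma maps_toE z x : maps_to phi z x -> mdom phi z -> phi z = x.
Proof. by move=> [g [e gz <-]] pz; exact: separated_rmap_eq. Qed.

Lemma near_mdom : \forall z \near generic Y, mdom phi z.
Proof.
by apply/genericP; exists (mdom phi); split=> //; [exact: mdom_open|exact: mdom_neq0].
Qed.

Lemma near_orbit (P : set Y) : (\forall z \near generic Y, P z) ->
  \forall y \near generic Y, \forall g \near generic (Gm k), P (g, phi y).
Proof. by move=> /near_slicer/(near_dominant (rational_action_dominant act)). Qed.

Lemma near_translate (P : set Y) : (\forall z \near generic Y, P z) ->
  \forall y \near generic Y, \forall g \near generic (Gm k), P (gm_mul g y.1, y.2).
Proof.
move=> /near_slicer/(near_dominant (@pr2_dominant k X)); apply: filterS => y.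
exact: generic_Gm_mulr.
Qed.

(** For generic y and then generic g, the three points at which the action axiom evaluates [phi] all
    lie in [mdom phi], so [maps_toE] applies to each. *)
Lemma action_generic : \forall y \near generic Y, \forall g \near generic (Gm k),
  phi (g, phi y) = phi (gm_mul g y.1, y.2).
Proof.
have [[W [oW nW actW]] _] := act.
have nearW : \forall z \near generic (irrProd (Gm k) Y), W z.
  by apply/genericP; exists W.
near=> y; near=> g.
have [x [z [/maps_toE xE /maps_toE zE /maps_toE z'E]]] : exists x z : X,
    [/\ maps_to phi y x, maps_to phi (g, x) z & maps_to phi (gm_mul g y.1, y.2) z].
  have : W (g, y) by near: g; near: y; exact: near_slicer.
  by case: (y) => h x /actW.
have yx : phi y = x by apply: xE; near: y; exact: near_mdom.
rewrite z'E; last by near: g; near: y; apply: (near_translate near_mdom).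
by rewrite -zE -yx //; near: g; near: y; apply: (near_orbit near_mdom).
Unshelve. all: by end_near.
Qed.

Lemma comorphism_quotient (F : funField X) (P Q : {poly funField X}) :
  phis F * (map_poly iota Q).[t] = (map_poly iota P).[t] ->
  \forall z \near generic Y, ffval (phi z) F * (map_poly (ffval z.2) Q).[gm_val z.1]
    = (map_poly (ffval z.2) P).[gm_val z.1].
Proof.
move=> FPQ; near=> z.
have <- : ffval z (phis F) = ffval (phi z) F.
  by near: z; exact: (comorphism_ffval (rational_action_dominant act)).
have <- : ffval z (map_poly iota Q).[t] = (map_poly (ffval z.2) Q).[gm_val z.1].
  by near: z; exact: ffval_KX_poly.
have <- : ffval z (map_poly iota P).[t] = (map_poly (ffval z.2) P).[gm_val z.1].
  by near: z; exact: ffval_KX_poly.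
by rewrite -FPQ; apply/esym; near: z; exact: ffvalM.
Unshelve. all: by end_near.
Qed.

(** Writing F(phi(g, phi(h, x))) = F(phi(gh, x)) as fractions on both sides gives P(g) / Q(g) with
    coefficients at phi(h, x) equal to P(gh) / Q(gh) with coefficients at x. This is the claim at
    (h, x), with g in place of the variable. *)
Lemma action_cross_mul (F : funField X) (P Q : {poly funField X}) :
  phis F * (map_poly iota Q).[t] = (map_poly iota P).[t] ->
  map_poly phis Q * (map_poly iota P \Po (t *: 'X)) =
  map_poly phis P * (map_poly iota Q \Po (t *: 'X)).
Proof.
move=> FPQ; apply/eqP; rewrite -subr_eq0; apply/eqP; apply: coord_t_transcendental.
(* The coordinate [s] of a second factor G_m replaces the polynomial variable, since it is
   transcendental over the function field of [Y]. *)
set s := coord_t Y; rewrite rmorphB !rmorphM /= hornerD hornerN !hornerM.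
have compE B : (map_poly (from_KX Y) (B \Po (t *: 'X))).[s] =
    (map_poly (from_KX Y) B).[from_KX Y t * s].
  by rewrite map_comp_poly map_polyZ map_polyX horner_comp hornerZ hornerX.
rewrite !compE -!map_poly_comp; apply/eqP; rewrite subr_eq0; apply/eqP.
have phisE A : \forall z \near generic (irrProd (Gm k) Y),
    ffval z (from_KX Y (phis A)) = ffval (phi z.2) A.
  apply: filterS2 (ffval_from_KX (phis A)) (near_dominant (@pr2_dominant k Y)
    (comorphism_ffval (rational_action_dominant act) A)) => z -> //.
have iotaE A : \forall z \near generic (irrProd (Gm k) Y),
    ffval z (from_KX Y (iota A)) = ffval z.2.2 A.
  apply: filterS2 (ffval_from_KX (iota A)) (near_dominant (@pr2_dominant k Y)
    (ffval_from_KX A)) => z -> //.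
have TE : \forall z \near generic (irrProd (Gm k) Y),
    ffval z (from_KX Y t * s) = gm_val z.2.1 * gm_val z.1.
  apply: filterS3 (ffvalM (from_KX Y t) s) (ffval_coord_t Y)
    (filterI (ffval_from_KX t) (near_dominant (@pr2_dominant k Y) (ffval_coord_t X))).
  by move=> z -> -> [-> /= ->].
have FE := comorphism_quotient FPQ.
have HP A : \forall z \near generic (irrProd (Gm k) Y),
    ffval z (map_poly (from_KX Y \o phis) A).[s] =
    (map_poly (ffval (phi z.2)) A).[gm_val z.1].
  have H := @ffval_map_horner k X (irrProd (Gm k) Y) (fun z => phi z.2)
    (from_KX Y \o phis) phisE A s.
  apply: filterS2 (ffval_coord_t Y) H.
  by move=> z -> ->.
have HI A : \forall z \near generic (irrProd (Gm k) Y),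
    ffval z (map_poly (from_KX Y \o iota) A).[from_KX Y t * s] =
    (map_poly (ffval z.2.2) A).[gm_val z.2.1 * gm_val z.1].
  have H := @ffval_map_horner k X (irrProd (Gm k) Y) (fun z => z.2.2)
    (from_KX Y \o iota) iotaE A (from_KX Y t * s).
  apply: filterS2 TE H.
  by move=> z -> ->.
have {HP HI} prodE A B : \forall z \near generic (irrProd (Gm k) Y),
    ffval z ((map_poly (from_KX Y \o phis) A).[s] *
      (map_poly (from_KX Y \o iota) B).[from_KX Y t * s]) =
    (map_poly (ffval (phi z.2)) A).[gm_val z.1] *
    (map_poly (ffval z.2.2) B).[gm_val z.2.1 * gm_val z.1].
  apply: filterS3 (HP A) (HI B) (ffvalM (map_poly (from_KX Y \o phis) A).[s]
    (map_poly (from_KX Y \o iota) B).[from_KX Y t * s]).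
  by move=> z <- <-.
(* Associativity is known for generic g depending on y, which is the form of genericity that
   [ffval_eq2] accepts. *)
apply: ffval_eq2; near=> y; near=> g.
have phi_assoc : phi (g, phi y) = phi (gm_mul g y.1, y.2).
  by near: g; near: y; exact: action_generic.
have F1 : ffval (phi (g, phi y)) F * (map_poly (ffval (phi y)) Q).[gm_val g]
    = (map_poly (ffval (phi y)) P).[gm_val g].
  by near: g; near: y; exact: (near_orbit FE).
have F2 : ffval (phi (gm_mul g y.1, y.2)) F *
    (map_poly (ffval y.2) Q).[gm_val (gm_mul g y.1)] =
    (map_poly (ffval y.2) P).[gm_val (gm_mul g y.1)].
  by near: g; near: y; exact: (near_translate FE).
have gE : gm_val (gm_mul g y.1) = gm_val y.1 * gm_val g by exact: mulrC.
transitivity ((map_poly (ffval (phi y)) Q).[gm_val g] *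
    (map_poly (ffval y.2) P).[gm_val y.1 * gm_val g]).
  by near: g; near: y; exact: near_slicer (prodE Q P).
transitivity ((map_poly (ffval (phi y)) P).[gm_val g] *
    (map_poly (ffval y.2) Q).[gm_val y.1 * gm_val g]).
  (* Both products equal the common value of [F] times the two values of [Q]. *)
  by rewrite -gE -F1 -F2 phi_assoc mulrCA mulrA.
by apply/esym; near: g; near: y; exact: near_slicer (prodE P Q).
Unshelve. all: by end_near.
Qed.


(** Divide numerator and denominator by their gcd, then by the leading coefficient of the
    denominator. *)
Lemma exists_reduced_fraction (F : funField Y) : exists P Q : {poly funField X},
  [/\ coprimep P Q, Q \is monic, (map_poly iota Q).[t] != 0
    & F * (map_poly iota Q).[t] = (map_poly iota P).[t]].
Proof.
have [P [Q [Q0 e]]] := rational_in_tP F.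
have nzQ : Q != 0 by apply: contra_neq Q0 => ->; rewrite rmorph0 horner0.
set G := gcdp P Q; set P1 := P %/ G; set Q1 := Q %/ G.
have PE : P = P1 * G by rewrite divpK // dvdp_gcdl.
have QE : Q = Q1 * G by rewrite divpK // dvdp_gcdr.
have nzQ1 : Q1 != 0 by apply: contra_neq nzQ => Q10; rewrite QE Q10 mul0r.
set c := (lead_coef Q1)^-1.
have c0 : c != 0 by rewrite invr_eq0 lead_coef_eq0.
have ic0 : iota c != 0 by rewrite fmorph_eq0.
move: Q0 e; rewrite {1 2}QE {1}PE !rmorphM /= !hornerM mulf_eq0 negb_or.
move=> /andP[Q10 G0]; rewrite mulrA => /(mulIf G0) e.
exists (c *: P1), (c *: Q1); rewrite !map_polyZ /= !hornerZ mulf_neq0 //; split=> //.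
- by rewrite coprimepZl // coprimepZr // coprimep_div_gcd // nzQ orbT.
- by rewrite monicE lead_coefZ mulVf // lead_coef_eq0.
- by rewrite mulrCA e.
Qed.

(** * Weights of semi-invariants *)

Lemma coord_t_neq0 : t != 0.
Proof.
apply/eqP => t0; have := @coord_t_transcendental k X 'X.
by rewrite map_polyX hornerX t0 => /(_ erefl)/eqP; rewrite polyX_eq0.
Qed.

(** A witness for weight 1 is a rational slice. *)
Definition is_weight (n : int) : Prop :=
  exists2 a : funField X, a != 0 & phis a = t ^ n * iota a.

Lemma is_weight0 : is_weight 0.
Proof. by exists 1; rewrite ?oner_neq0 // !rmorph1 mulr1. Qed.

Lemma is_weightB m n : is_weight m -> is_weight n -> is_weight (m - n).
Proof.
move=> [a a0 ea] [b b0 eb]; exists (a / b); first by rewrite mulf_neq0 ?invr_eq0.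
by rewrite !fmorph_div ea eb invfM mulrACA expfzDr ?coord_t_neq0 // invr_expz.
Qed.

Lemma coef_is_weight (a : funField X) (i m : nat) : a != 0 ->
  iota a * t ^+ i = t ^+ m * phis a -> is_weight (i%:Z - m%:Z).
Proof.
move=> a0 e; exists a => //; have t0 := coord_t_neq0.
apply: (mulfI (expf_neq0 m t0)).
by rewrite -e mulrA [t ^+ m]exprnP -expfzDr // addrC subrK mulrC.
Qed.

(** Nonzero coefficients of the reduced fraction P / Q of [phis F] occur only at indices congruent
    to [m] modulo [d]. Replacing g by g zeta therefore multiplies both P(g) and Q(g) by zeta^m and
    preserves their quotient. *)
Lemma weights_translate (d : nat) (zeta : Gm k) (F : funField X) :
  gm_val zeta ^+ d = 1 -> (forall n, is_weight n -> (d %| n)%Z) ->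
  \forall g \near generic (Gm k), \forall x \near generic X,
    ffval (phi (gm_mul g zeta, x)) F = ffval (phi (g, x)) F.
Proof.
move=> zd wd; have [P [Q [cPQ mQ Q0 e]]] := exists_reduced_fraction (phis F).
have cf := monic_fraction_coefs coord_t_neq0 cPQ mQ (action_cross_mul e).
set m := (size Q).-1 in cf.
(* The weight j - m of a nonzero coefficient of index j is a multiple of [d]. *)
have zE (a : funField X) j : a != 0 -> iota a * t ^+ j = t ^+ m * phis a ->
    gm_val zeta ^+ j = gm_val zeta ^+ m.
  move=> a0 /(coef_is_weight a0)/wd/dvdzP[q jm].
  have z0 : gm_val zeta != 0 by exact: (valP (zeta : gmSpace k)).
  have -> : gm_val zeta ^+ j = gm_val zeta ^ (q * d%:Z + m%:Z) by rewrite -jm subrK.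
  by rewrite expfzDr // [q * _]mulrC -exprz_exp -!exprnP zd exp1rz mul1r.
have hz (A : {poly funField X}) x g :
    (forall j, iota A`_j * t ^+ j = t ^+ m * phis A`_j) ->
    (map_poly (ffval x) A).[gm_val (gm_mul g zeta)] =
    gm_val zeta ^+ m * (map_poly (ffval x) A).[gm_val g].
  move=> hA; rewrite !(@horner_coef_wide _ (size A)) ?size_poly // mulr_sumr.
  apply: eq_bigr => j _; rewrite coef_map_id0 ?ffval0 //.
  have [->|Aj] := eqVneq A`_j 0; first by rewrite ffval0 !mul0r mulr0.
  rewrite -(zE _ _ Aj (hA j)) [RHS]mulrCA -exprMn; congr (_ * _ ^+ _).
  exact: mulrC.
have nQ : \forall z \near generic Y, (map_poly (ffval z.2) Q).[gm_val z.1] != 0.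
  by apply: filterS2 (ffval_neq0 Q0) (ffval_KX_poly Q) => z + <-.
have E := near_slicel (comorphism_quotient e).
near=> g; near=> x.
have F1 : ffval (phi (g, x)) F * (map_poly (ffval x) Q).[gm_val g] =
    (map_poly (ffval x) P).[gm_val g] by near: x; near: g.
have F2 : ffval (phi (gm_mul g zeta, x)) F *
    (map_poly (ffval x) Q).[gm_val (gm_mul g zeta)] =
    (map_poly (ffval x) P).[gm_val (gm_mul g zeta)].
  by near: x; near: g; exact: (generic_Gm_mulr zeta E).
have nz : (map_poly (ffval x) Q).[gm_val (gm_mul g zeta)] != 0.
  by near: x; near: g; exact: (generic_Gm_mulr zeta (near_slicel nQ)).
apply: (mulIf nz); rewrite F2 (hz P x g (fun j => (cf j).2)) -F1.
by rewrite (hz Q x g (fun j => (cf j).1)) mulrCA.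
Unshelve. all: by end_near.
Qed.

End Homogeneity.

(** * Coordinates of an affine chart *)

Lemma subSpace_regular (k : fieldType) (X : funSpace k) (U : set X) (f : subSpace U -> k) :
  open U -> regular [set: subSpace U] f ->
  exists2 h : X -> k, regular U h & forall u : set_type U, h (val u) = f u.
Proof.
(* The value 0 outside [U] is arbitrary; on [U], regularity is checked locally by writing [f] as a
   quotient of regular functions of [X]. *)
move=> oU rf; pose h x := if insub x is Some u then f (u : set_type U) else 0.
have hE (u : set_type U) : h (val u) = f u by rewrite /h valK.
exists h => //; apply: regular_glue => // x Ux.
pose u : set_type U := SigSub (mem_set Ux).
have [W [a [b [[V1 [a' [oV1 ra' WE aE]]] [V2 [b' [oV2 rb' WE' bE]]] Wu bu e]]]] := rf u I.
have V1x : V1 x by move: Wu; rewrite WE.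
have V2x : V2 x by move: Wu; rewrite WE'.
have oN := regular_neq0 oV2 rb'.
set D := (U `&` V1) `&` (V2 `&` [set x | b' x != 0]).
have oD : open D by apply: openI => //; exact: openI.
exists D; split=> //.
- by split; split=> //=; rewrite -(bE u).
- by move=> y [[]].
have ra := regular_restr oV1 oD (fun y Dy => Dy.1.2) ra'.
have rb := regular_restr oN oD (@subIsetr _ _ _) (regular_inv oV2 rb').
apply: (regular_ext oD _ (regular_mul oD ra rb)) => y [[Uy V1y] [V2y by0]].
pose v : set_type U := SigSub (mem_set Uy).
rewrite -[y]/(val v) hE e ?aE ?bE ?WE //.
Qed.

(** The [h i] are the ambient affine coordinates composed with the isomorphism to a closed subset;
    they separate points because that isomorphism is injective. *)
Lemma affine_coordinates (k : fieldType) (X : funSpace k) (U : set X) :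
  open U -> affine (subSpace U) -> exists n (h : 'I_n -> X -> k),
    (forall i, regular U (h i)) /\
    (forall x y, U x -> U y -> (forall i, h i x = h i y) -> x = y).
Proof.
move=> oU [n [Z [_ [alpha [beta [malpha _ alphaK _]]]]]].
pose c i (z : subSpace Z) : k := (val (z : set_type Z) : 'rV[k]_n) ord0 i.
have rc i : regular [set: subSpace Z] (c i).
  have subc : subBase_pred (A := Z) setT (c i).
    exists setT, (fun v => (v : 'rV[k]_n) ord0 i); split=> //; first exact: openT.
    move=> v _; exists setT, (fun v => (v : 'rV[k]_n) ord0 i), (fun=> 1).
    split; [|exact: affBase_cst|by []|exact: oner_neq0|by move=> y _ _ _; rewrite divr1].
    by split=> //; exists (mpoly.mpolyX _ (mpoly.mnm1 i)) => w; rewrite mpoly.mevalXU.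
  move=> z _; exists setT, (c i), (fun=> 1).
  split; [exact: subc|exact: subBase_cst|by []|exact: oner_neq0|].
  by move=> y _ _ _; rewrite divr1.
have rca i : exists2 h : X -> k, regular U h &
    forall u : set_type U, h (val u) = c i (alpha u).
  apply: subSpace_regular => //.
  have := (malpha setT openT).2 _ (rc i).
  by rewrite preimage_setT setIT.
exists n, (fun i => projT1 (cid2 (rca i))); split=> [i|x y Ux Uy e].
  by case: (cid2 (rca i)).
pose u : set_type U := SigSub (mem_set Ux); pose v : set_type U := SigSub (mem_set Uy).
suff uv : u = v by rewrite -[x]/(val u) uv.
apply: (can_inj alphaK); apply: val_inj; apply/rowP => i.
have := e i; case: (cid2 (rca i)) => h /= _ hE.
by rewrite -[x]/(val u) -[y]/(val v) !hE.
Qed.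

(** * Existence of the slice from faithfulness *)

Theorem mainTheorem3 (k : closedFieldType) (char0 : [pchar k] =i pred0)
    (X : variety k) (phi : ratMap (irrProd (Gm k) X) X)
    (act : rational_action phi) (faith : faithful phi) :
  exists s : funField X,
    s <> 0 /\ action_comorphism act s = coord_t X * from_KX X s.
Proof.
have sepX := @var_separated k X.
suff [s s0 sE] : is_weight act 1 by exists s; split=> //; exact/eqP.
apply: contrapT => w1.
have [d d1 dw] := int_subgroup_dvd (is_weight0 act) (@is_weightB _ _ _ act) w1.
have [z z1 zd] := nontrivial_root_of_unity char0 d1.
have z0 : z != 0.
  by apply: contra_eq_neq zd => ->; rewrite expr0n gtn_eqF 1?ltnW // eq_sym oner_neq0.
pose zeta : Gm k := (exist _ z z0 : gmSpace k).
have [m [U [oaU covU]]] := var_finite_type X.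
have [x0 _] := irrT X; have [i _ Ux0] : (\bigcup_i U i) x0 by rewrite covU.
have [oU affU] := oaU i.
have [n [h [rh hinj]]] := affine_coordinates oU affU.
have nU : U i !=set0 by exists x0.
have domphi := rational_action_dominant act.
pose H j := \pi_(funField X) (RatRep oU nU (rh j)).
(* At such points phi(g, x) lies in the chart and the rational functions [H j] take the actual
   coordinates there as values. *)
pose good (g : Gm k) (x : X) := [/\ mdom phi (g, x), U i (phi (g, x))
  & forall j, ffval (phi (g, x)) (H j) = h j (phi (g, x))].
have near_good : \forall g \near generic (Gm k), \forall x \near generic X, good g x.
  have nH : \forall x \near generic X, forall j, ffval x (H j) = h j x.
    by apply: filter_forall => j; exact: ffval_pi.
  have nUi : \forall x \near generic X, U i x by apply/genericP; exists (U i).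
  have nz : \forall z \near generic (irrProd (Gm k) X),
      [/\ mdom phi z, U i (phi z) & forall j, ffval (phi z) (H j) = h j (phi z)].
    by apply: filterS3 (near_mdom phi) (near_dominant domphi nUi) (near_dominant domphi nH).
  exact: near_slicel nz.
have near_H : \forall g \near generic (Gm k), forall j, \forall x \near generic X,
    ffval (phi (gm_mul g zeta, x)) (H j) = ffval (phi (g, x)) (H j).
  apply: (@filter_forall _ _ (fun j g => \forall x \near generic X,
    ffval (phi (gm_mul g zeta, x)) (H j) = ffval (phi (g, x)) (H j))) => j.
  exact: (weights_translate (zeta := zeta) sepX (H j) zd dw).
(* A single g for which both g and g zeta are good at generic x, and for which the coordinates of
   the two images agree. *)
have [g [gg [gzg gH]]] := filter_ex (filterI near_good
  (filterI (generic_Gm_mulr zeta near_good) near_H)).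
have /genericP[W [oW nW sW]] : \forall x \near generic X,
    [/\ mdom phi (g, x), mdom phi (gm_mul g zeta, x) & phi (gm_mul g zeta, x) = phi (g, x)].
  have {}gH : \forall x \near generic X, forall j,
      ffval (phi (gm_mul g zeta, x)) (H j) = ffval (phi (g, x)) (H j).
    exact: filter_forall.
  apply: filterS3 gg gzg gH => x [m1 U1 e1] [m2 U2 e2] e12.
  by split=> //; apply: hinj => // j; rewrite -e1 -e2.
(* The chart coordinates separate points, so g and g zeta give the same birational map; faithfulness
   then yields zeta = 1, contrary to the choice of [z]. *)
have : g = gm_mul g zeta.
  apply: faith; exists W; split=> // x /sW[m1 m2 e].
  have refl : rmap_eq phi phi.
    by exists (mdom phi); split=> //; [exact: mdom_open | exact: mdom_neq0].
  by exists (phi (g, x)); split; exists phi; split.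
move=> /(congr1 (@gm_val k)); rewrite -[LHS]mulr1.
move=> /(mulfI (valP (g : gmSpace k)))/esym/eqP.
exact/negP.
Qed.
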